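(* The projection $\Pi$ from an open subset of $Z$ (the complement of the zero sections of $Z^+$ and $Z^-$) to $T$ is given by a quotient of $Z$ by a local (holomorphic) $\mathbb C^{\times}$ action $\circ$; that is, there is a local $\mathbb C^\times$ action $\circ$ on $Z$ for which $\Pi$ is the quotient map. Here $Z$, $T$ and $\Pi$ are constructed, as described in the context, from a complexification $\Sigma$ of a real-analytic surface $S$ with a real-analytic conformal Cartan geometry.
   Context: **Cartan data.** A conformal Cartan geometry on a real surface $S$ is $(V_{\mathbb R},\langle,\rangle,\Lambda_{\mathbb R},\mathcal D)$: a rank $4$ real vector bundle with an inner product of signature $(3,1)$, a null line subbundle, and a linear metric connection $\mathcal D$ such that $\delta:=\mathcal D|_{\Lambda}\bmod\Lambda$ is an isomorphism $TS\otimes\Lambda\to\Lambda^\perp/\Lambda$. A complex conformal Cartan geometry on a complex surface is the same with all objects holomorphic and $\langle,\rangle$ complex bilinear. $(\Sigma,V,\langle,\rangle,\Lambda,\mathcal D)$ is a complex surface with a complex conformal Cartan geometry which is a complexification (holomorphic extension) of a real-analytic conformal Cartan geometry on $S$. **Null objects.** $U^\pm\subset\Lambda^\perp$ are the two totally null rank $2$ subbundles containing $\Lambda$ (so $U^+\cap U^-=\Lambda$); $t^\pm\subset T\Sigma$ are the line subbundles with $\delta(\Lambda\otimes t^\pm)=U^\pm/\Lambda$; $C^\pm$ are the families of integral curves of $t^\pm$; $F^\pm=\mathbb P(U^\pm)$, $\mathbb P(\Lambda)=F^+\cap F^-$ fibrewise. $\mathcal D_X$ preserves $U^\pm$ for $X\in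 t^\pm$, so curves of $C^\pm$ lift horizontally to $F^\pm$. $T^\pm$ is the leaf space of the foliation of $F^\pm$ by these lifts. **Restrictions on $\Sigma$.** $\Sigma$ is (locally) restricted to a connected open set so that: curves in $C^\pm$ are simply connected and their leaf spaces are Hausdorff manifolds; $T^\pm$ are Hausdorff complex manifolds, each leaf meets each fibre of $F^\pm$ at most once and meets $\mathbb P(\Lambda)$ at most once; $\Sigma$ is $\pm$-convex, i.e. every curve of $C^+$ meets every curve of $C^-$, in exactly one point. Analogous restrictions hold for the lifts to $\tilde U^\pm$ below. Fix intersecting curves $c_0^\pm\in C^\pm$; $T^\pm$ is identified with $F^\pm|_{c_0^\mp}$. **The surface $T$.** $T=T^+\sqcup_\sim T^-$, where $s^+\in T^+$ is identified with $s^-\in T^-$ if $s^+\cap s^-=\{\mathbb P(\Lambda)_x\}$ for some $x\in\Sigma$. **The space $Z$.** Write $V\cong W\otimes\hat W$ with $W,\hat W$ of rank $2$, with symplectic forms $\epsilon,\hat\epsilon$ such that $\langle,\rangle=\epsilon\otimes\hat\epsilon$, and $\Lambda=\Lambda^+\otimes\Lambda^-$ with $\Lambda^+\subset W$, $\Lambda^-\subset\hat W$, $U^+=\Lambda^+\otimes\hat W$, $U^-=W\otimes\Lambda^-$. $\mathcal D$ is the tensor product of connections on $W,\hat W$ preserving $\epsilon,\hat\epsilon$; these preserve $\Lambda^\pm$ along curves of $C^\pm$. Put $\tilde U^\pm=U^\pm\otimes(\Lambda^\pm)^*\otimes(\Lambda^\pm)^*$ (so $\mathbb P(\tilde U^\pm)=F^\pm$),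 $L^+=\Lambda^-\otimes(\Lambda^+)^*\subset\tilde U^+$, $L^-=\Lambda^+\otimes(\Lambda^-)^*=(L^+)^*\subset\tilde U^-$. $V^\pm$ is the leaf space of horizontal lifts of $C^\pm$ curves to $\tilde U^\pm$, identified with $\tilde U^\pm|_{c_0^\mp}$. $W^\pm\subset V^\pm$ consists of the zero section $\underline 0$ and of all leaves meeting $L^\pm\setminus\underline 0$. Choose open tubular neighbourhoods $B^\pm$ of the zero section in $\tilde U^\pm|_{c_0^\mp}$ (disc-like in the fibres). For $v^\pm\in W^\pm\setminus\underline 0$ let $v^+\sim v^-$ iff $v^+\cap L^+=\{\ell\}$ and $v^-\cap L^-=\{\ell^*\}$ lie over the same point of $\Sigma$ and $\ell^*(\ell)=1$; $B^\pm$ are such that the image of $B^+\cap(W^+\setminus\underline 0)$ under the gluing is disjoint from $B^-$. $Z^\pm=B^\pm\cup W^\pm$, $Z=Z^+\sqcup_\sim Z^-$. **Projection.** The gluings of $Z^\pm$ and $T^\pm$ are compatible, so fibrewise projectivisation $v\mapsto[v]$ of nonzero vectors of $\tilde U^\pm|_{c_0^\mp}$ defines the projection $\Pi$ from the open subset of $Z$ given by the complement of the zero sections of $Z^+$ and $Z^-$ to $T$. *)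

(* Defs.v *)
From Stdlib Require Export Relations.Relation_Operators.
Set Warnings "-notation-overridden,-ambiguous-paths,-notation-incompatible-prefix".
From HB Require Import structures.
From mathcomp Require Export all_boot all_order all_algebra.
From mathcomp Require Export complex.
From mathcomp Require Export all_classical all_reals all_analysis.

Set Implicit Arguments.
Unset Strict Implicit.
Unset Printing Implicit Defensive.

Import Order.TTheory GRing.Theory Num.Theory.
Import numFieldNormedType.Exports.

Local Open Scope classical_set_scope.
Local Open Scope ring_scope.

(* [reg f u] reads "f is regular in a neighbourhood of u".  Manifolds, bundles,
   connections and Cartan geometries are defined once, over a field K and a
   notion of regularity, and used for (R, real-analytic) and (C, holomorphic). *)
Definition regularity (K : numFieldType) : Type :=
  forall m n : nat, ('rV[K]_m -> 'rV[K]_n) -> 'rV[K]_m -> Prop.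

(* R[i] has to be seen as a numFieldType to receive its topology. *)
Definition Cplx (R : realType) : numFieldType := R[i].

Definition cplx_mx (R : realType) (n : nat) (u : 'rV[R]_n) : 'rV[Cplx R]_n :=
  map_mx (fun x : R => (x%:C)%C : Cplx R) u.

Definition holomorphic (R : realType) : regularity (Cplx R) :=
  fun m n f u => \forall v \near u, differentiable f v.

(* Sum of a power series in m variables; the bound on the coefficients makes
   the convergence absolute, so the order of summation is immaterial. *)
Definition real_analytic (R : realType) : regularity R :=
  fun m n f u =>
  exists (r B : R) (a : 'I_n -> ('I_m -> nat) -> R),
  [/\ 0 < r,
      forall j k, `|a j k| * r ^+ (\sum_(i < m) k i)%N <= B &
      forall v : 'rV[R]_m, (forall i, `|v 0 i - u 0 i| < r) ->
      forall j, (fun N : nat => \sum_(k : {ffun 'I_m -> 'I_N})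
          a j (fun i => k i) * \prod_(i < m) (v 0 i - u 0 i) ^+ k i)
        @ \oo --> f v 0 j].

Section Manifolds.
Variables (K : numFieldType) (reg : regularity K).

Record chart (M : Type) (n : nat) := Chart {
  cdom : set M;
  cphi : M -> 'rV[K]_n;
  cpsi : 'rV[K]_n -> M }.

Definition is_chart (M : topologicalType) n (c : chart M n) : Prop :=
  [/\ open (cdom c), open (cphi c @` cdom c),
      forall x, cdom c x -> cpsi c (cphi c x) = x,
      {within cdom c, continuous (cphi c)} &
      {within cphi c @` cdom c, continuous (cpsi c)}].

(* The preferred charts [chart_at] only serve to name tangent vectors: T_x M is
   'rV[K]_n, read in the chart [chart_at x]. *)
Record manifold (n : nat) := Manifold {
  mcar :> topologicalType;
  atlas : set (chart mcar n);
  chart_at : mcar -> chart mcar n;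
  atlasP : forall c, atlas c -> is_chart c;
  atlas_compat : forall c c' x, atlas c -> atlas c' -> cdom c x -> cdom c' x ->
    reg (cphi c' \o cpsi c) (cphi c x);
  chart_atP : forall x, atlas (chart_at x) /\ cdom (chart_at x) x }.

Arguments atlas {n} M : rename.

(* p, from an open set of K^m to M, is regular near u *)
Definition mplot n (M : manifold n) m (p : 'rV[K]_m -> M) (u : 'rV[K]_m) : Prop :=
  {for u, continuous p} /\
  forall c, atlas M c -> cdom c (p u) -> reg (cphi c \o p) u.

(* f is a regular map near x *)
Definition rmap m n (M : manifold m) (N : manifold n) (f : M -> N) (x : M) : Prop :=
  forall c, atlas M c -> cdom c x -> mplot (M := N) (f \o cpsi c) (cphi c x).

(* f is a regular function near x *)
Definition rfun n (M : manifold n) (f : M -> K) (x : M) : Prop :=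
  forall c, atlas M c -> cdom c x ->
    reg (fun u => const_mx (f (cpsi c u)) : 'rV[K]_1) (cphi c x).

Definition dfun n (M : manifold n) (f : M -> K) (x : M) (X : 'rV[K]_n) : K :=
  ('d (fun u => const_mx (f (cpsi (chart_at x) u)) : 'rV[K]_1)
     (cphi (chart_at x) x) X) 0 0.

Definition velocity n (M : manifold n) (g : 'rV[K]_1 -> M) (u : 'rV[K]_1) : 'rV[K]_n :=
  'd (cphi (chart_at (g u)) \o g) u (const_mx 1).

(* the tangent vector at x whose components in the chart c are v *)
Definition coordinate_vector n (M : manifold n) (c : chart M n) (v : 'rV[K]_n)
    (x : M) : 'rV[K]_n :=
  'd (cphi (chart_at x) \o cpsi c) (cphi c x) v.

(* i restricts to an isomorphism of the open set D onto an open set of N *)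
Definition open_embedding n (M N : manifold n) (D : set M) (i : M -> N) : Prop :=
  [/\ open D, {in D &, injective i} &
      forall x, D x -> rmap i x /\
        exists g : N -> M, [/\ rmap g (i x),
          \forall y \near x, g (i y) = y &
          \forall z \near i x, D (g z) /\ i (g z) = z]].

(* The manifold N is DA |_| DB / E, where DA and DB are open in A and B, with its
   glued structure: the conditions determine N, i, j up to a unique
   isomorphism. *)
Definition is_gluing n (A B N : manifold n) (DA : set A) (DB : set B)
    (E : A -> B -> Prop) (i : A -> N) (j : B -> N) : Prop :=
  [/\ open_embedding DA i, open_embedding DB j,
      (forall z : N, (exists2 a, DA a & i a = z) \/ (exists2 b, DB b & j b = z)) &
      forall a b, DA a -> DB b -> (i a = j b <-> E a b)].

(* q : A -> N is the quotient, in the regular category, of the subset A of X by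
   the relation E: it is surjective, its fibres are the E-classes, and it is a
   submersion, i.e. it is regular and through every point of A passes a regular
   local section of q.  The space X is known through its regular maps
   [P : K^m -> X], so that this applies to manifolds and to total spaces of
   bundles alike. *)
Definition quotient_map (X : Type)
    (P : forall m, ('rV[K]_m -> X) -> 'rV[K]_m -> Prop) (A : set X)
    n (N : manifold n) (q : X -> N) (E : X -> X -> Prop) : Prop :=
  [/\ forall z : N, exists2 x, A x & q x = z,
      forall x y, A x -> A y -> (q x = q y <-> E x y),
      forall m (p : 'rV[K]_m -> X) u, P m p u -> (\forall v \near u, A (p v)) ->
        mplot (M := N) (q \o p) u &
      forall x, A x -> forall c, atlas N c -> cdom c (q x) ->
        exists s : 'rV[K]_n -> X,
        [/\ P n s (cphi c (q x)), s (cphi c (q x)) = x &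
            \forall v \near cphi c (q x), A (s v) /\ q (s v) = cpsi c v]].

(* A local action of the multiplicative group of K on M: [dom] is an open
   neighbourhood of {1} x M in K^* x M, and the axioms of an action hold
   wherever all the terms are defined. *)
Definition local_Gm_action n (M : manifold n) (dom : set (K * M))
    (act : K -> M -> M) : Prop :=
  [/\ open dom, (forall a x, dom (a, x) -> a != 0),
      (forall x, dom (1, x) /\ act 1 x = x),
      (forall a b x, dom (b, x) -> dom (a, act b x) -> dom (a * b, x) ->
         act a (act b x) = act (a * b) x) &
      (forall a x, dom (a, x) -> dom (a^-1, act a x) /\ act a^-1 (act a x) = x)].

(* regularity on dom of K * M -> M, in the product charts of K * M *)
Definition regular_action n (M : manifold n) (dom : set (K * M))
    (act : K -> M -> M) : Prop :=
  forall a x, dom (a, x) -> forall c, atlas M c -> cdom c x ->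
    mplot (M := M) (fun w : 'rV[K]_(1 + n) => act (lsubmx w 0 0) (cpsi c (rsubmx w)))
      (row_mx (const_mx a) (cphi c x)).

(* the orbits of a local action: the equivalence relation it generates *)
Definition local_orbit n (M : manifold n) (dom : set (K * M))
    (act : K -> M -> M) : M -> M -> Prop :=
  clos_refl_sym_trans M (fun x y => exists a, dom (a, x) /\ y = act a x).

End Manifolds.

Arguments atlas {K reg n} M : rename.

Section Bundles.
Variables (K : numFieldType) (reg : regularity K).
Variables (n : nat) (M : manifold reg n).

Record frame (F : M -> vectType K) (k : nat) := Frame {
  fdom : set M;
  fvec : forall x, k.-tuple (F x) }.

(* a vector bundle of rank k, given by its fibres and an atlas of local frames *)
Record vbundle (k : nat) := VBundle {
  fib :> M -> vectType K;
  frames : set (frame fib k);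
  frames_cover : forall x, exists2 e, frames e & fdom e x;
  framesP : forall e, frames e ->
    open (fdom e) /\ forall x, fdom e x -> basis_of fullv (fvec e x);
  frames_compat : forall e e' x, frames e -> frames e' -> fdom e x -> fdom e' x ->
    forall i j, rfun (fun y => coord (fvec e' y) j (tnth (fvec e y) i)) x }.

Arguments frames {k} E : rename.

(* the section s is regular near x *)
Definition rsec k (E : vbundle k) (s : forall x, E x) (x : M) : Prop :=
  forall e, frames E e -> fdom e x ->
  forall i, rfun (fun y => coord (fvec e y) i (s y)) x.

(* p, from an open set of K^m to the total space of E, is regular near u *)
Definition bplot k (E : vbundle k) m (p : 'rV[K]_m -> {x : M & E x}) (u : 'rV[K]_m)
    : Prop :=
  mplot (M := M) (fun v => tag (p v)) u /\
  forall e, frames E e -> fdom e (tag (p u)) ->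
  forall i, reg (fun v => const_mx (coord (fvec e (tag (p v))) i (tagged (p v))) : 'rV[K]_1) u.

Definition subbundle k (E : vbundle k) (r : nat) (L : forall x, {vspace E x}) : Prop :=
  forall x, exists s : 'I_r -> forall y, E y,
    (forall i, rsec (s i) x) /\
    \forall y \near x, basis_of (L y) [seq s i y | i <- enum 'I_r].

(* s is a regular section of the subbundle L near x *)
Definition rsec_in k (E : vbundle k) (L : forall x, {vspace E x})
    (s : forall x, E x) (x : M) : Prop :=
  rsec s x /\ \forall y \near x, s y \in L y.

(* a fibrewise bilinear form or product, regular on regular sections *)
Definition bilinear_form k (E : vbundle k) (b : forall x, E x -> E x -> K) : Prop :=
  [/\ forall x v, scalar (b x v), forall x w, scalar (b x ^~ w) &
      forall x s t, rsec s x -> rsec t x -> rfun (fun y => b y (s y) (t y)) x].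

Definition bilinear_product k1 k2 k3 (E1 : vbundle k1) (E2 : vbundle k2)
    (E3 : vbundle k3) (b : forall x, E1 x -> E2 x -> E3 x) : Prop :=
  [/\ forall x v, linear (b x v), forall x w, linear (b x ^~ w) &
      forall x s t, rsec s x -> rsec t x -> rsec (fun y => b y (s y) (t y)) x].

Definition nondegenerate k (E : vbundle k) (b : forall x, E x -> E x -> K) : Prop :=
  forall x v, (forall w, b x v w = 0) -> v = 0.

(* a linear connection; [D x X s] is the derivative at x of the section s in the
   direction of X in T_x M, meaningful when s is regular near x *)
Definition is_connection k (E : vbundle k)
    (D : forall x, 'rV[K]_n -> (forall y, E y) -> E x) : Prop :=
  [/\ forall x s, linear (D x ^~ s),
      forall x X s t, rsec s x -> rsec t x ->
        D x X (fun y => s y + t y) = D x X s + D x X t,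
      forall x X f s, rfun f x -> rsec s x ->
        D x X (fun y => f y *: s y) = dfun f x X *: s x + f x *: D x X s,
      forall x X s t, rsec s x -> (\forall y \near x, s y = t y) ->
        D x X s = D x X t &
      forall x c v s, atlas M c -> cdom c x -> rsec s x ->
        rsec (fun y => D y (coordinate_vector c v y) s) x].

Record connection k (E : vbundle k) := Connection {
  nabla :> forall x, 'rV[K]_n -> (forall y, E y) -> E x;
  connectionP : is_connection nabla }.

Definition parallel_form k (E : vbundle k) (D : connection E)
    (b : forall x, E x -> E x -> K) : Prop :=
  forall x X s t, rsec s x -> rsec t x ->
    dfun (fun y => b y (s y) (t y)) x X = b x (D x X s) (t x) + b x (s x) (D x X t).

End Bundles.

Arguments frames {K reg n M k} E : rename.

Section Cartan.
Variables (K : numFieldType) (reg : regularity K) (M : manifold reg 2).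

Record cartan := Cartan {
  cV : vbundle M 4;
  cmet : forall x, cV x -> cV x -> K;
  cL : forall x, {vspace cV x};
  cD : connection cV;
  cmet_bilinear : bilinear_form cmet;
  cmet_sym : forall x (v w : cV x), cmet v w = cmet w v;
  cmet_nondeg : nondegenerate cmet;
  cL_line : subbundle 1 cL;
  cL_null : forall x v w, v \in cL x -> w \in cL x -> cmet v w = 0;
  cD_metric : parallel_form cD (@cmet);
  (* delta = D|_L mod L, evaluated on a nonzero l in L, is a bijection of T_x M
     onto L^perp / L *)
  c_delta : forall x l, rsec_in cL l x -> l x != 0 ->
    (forall X v, v \in cL x -> cmet (cD x X l) v = 0) /\
    (forall w, (forall v, v \in cL x -> cmet w v = 0) ->
       exists! X, w - cD x X l \in cL x) }.

(* the two totally null rank 2 subbundles containing the null line bundle, in a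
   given order *)
Record null_planes (G : cartan) := NullPlanes {
  Up : forall x, {vspace cV G x};
  Um : forall x, {vspace cV G x};
  Up_plane : subbundle 2 Up;
  Um_plane : subbundle 2 Um;
  Up_null : forall x v w, v \in Up x -> w \in Up x -> cmet v w = 0;
  Um_null : forall x v w, v \in Um x -> w \in Um x -> cmet v w = 0;
  UpUm : forall x, (Up x :&: Um x)%VS = cL G x }.

(* V = W (x) Wh: a bilinear product V <- W * Wh taking a pair of bases to a
   basis, together with the factorisations of the metric, of the connection, of
   the null line and of the null planes. *)
Record spinors (G : cartan) (U : null_planes G) := Spinors {
  sW : vbundle M 2;
  sWh : vbundle M 2;
  tens : forall x, sW x -> sWh x -> cV G x;
  eps : forall x, sW x -> sW x -> K;
  epsh : forall x, sWh x -> sWh x -> K;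
  sD : connection sW;
  sDh : connection sWh;
  sLp : forall x, {vspace sW x};
  sLm : forall x, {vspace sWh x};
  tens_bilinear : bilinear_product tens;
  tens_basis : forall x,
    basis_of fullv [seq tens w v | w <- vbasis {:sW x}, v <- vbasis {:sWh x}];
  eps_bilinear : bilinear_form eps;
  eps_alt : forall x (w : sW x), eps w w = 0;
  eps_nondeg : nondegenerate eps;
  epsh_bilinear : bilinear_form epsh;
  epsh_alt : forall x (w : sWh x), epsh w w = 0;
  epsh_nondeg : nondegenerate epsh;
  tens_met : forall x (w w' : sW x) (v v' : sWh x),
    cmet (tens w v) (tens w' v') = eps w w' * epsh v v';
  sD_eps : parallel_form sD eps;
  sDh_epsh : parallel_form sDh epsh;
  tens_D : forall x X s t, rsec s x -> rsec t x ->
    cD G x X (fun y => tens (s y) (t y)) =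
      tens (sD x X s) (t x) + tens (s x) (sDh x X t);
  sLp_line : subbundle 1 sLp;
  sLm_line : subbundle 1 sLm;
  tens_L : forall x v, v \in cL G x <->
    exists a b, [/\ a \in sLp x, b \in sLm x & v = tens a b];
  tens_Up : forall x v, v \in Up U x <-> exists a b, a \in sLp x /\ v = tens a b;
  tens_Um : forall x v, v \in Um U x <-> exists a b, b \in sLm x /\ v = tens a b }.

(* All the "plus" objects are built from the data below, and the "minus" ones
   are the same with W, Wh exchanged. *)
Record half (G : cartan) := Half {
  hU : forall x, {vspace cV G x};
  hE : vbundle M 2;
  hF : vbundle M 2;
  hten : forall x, hE x -> hF x -> cV G x;
  hDE : connection hE;
  hDF : connection hF;
  hA : forall x, {vspace hE x};
  hB : forall x, {vspace hF x} }.

Definition half_plus (G : cartan) (U : null_planes G) (s : spinors U) : half G :=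
  @Half G (Up U) (sW s) (sWh s) (@tens _ _ s) (sD s) (sDh s) (@sLp _ _ s) (@sLm _ _ s).

Definition half_minus (G : cartan) (U : null_planes G) (s : spinors U) : half G :=
  @Half G (Um U) (sWh s) (sW s) (fun x b a => tens a b) (sDh s) (sD s)
    (@sLm _ _ s) (@sLp _ _ s).

End Cartan.

Definition lorentzian (R : realType) (S : manifold (@real_analytic R) 2)
    (G : cartan S) : Prop :=
  forall x, exists b : 'I_4 -> cV G x, forall i j,
    cmet (b i) (b j) = if i == j then (if i == ord0 then -1 else 1) else 0.

Section Complexification.
Variables (R : realType).
Variables (S : manifold (@real_analytic R) 2) (Sigma : manifold (@holomorphic R) 2).

(* Read in the preferred charts at x and at i x, the map i is the restriction to
   R^2 of the local biholomorphism H of C^2; so Sigma is, along i(S), a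
   complexification of S, and X |-> 'd H (cplx_mx X) is the derivative of i. *)
Definition extends (i : S -> Sigma) (x : S) (H : 'rV[Cplx R]_2 -> 'rV[Cplx R]_2) : Prop :=
  let u0 := cphi (chart_at x) x in
  [/\ holomorphic H (cplx_mx u0), injective ('d H (cplx_mx u0)) &
      \forall u \near u0,
        cphi (chart_at (i x)) (i (cpsi (chart_at x) u)) = H (cplx_mx u)].

(* the holomorphic section t extends the real-analytic section s near x *)
Definition sec_extends k (E : vbundle S k) (F : vbundle Sigma k) (i : S -> Sigma)
    (iE : forall x, E x -> F (i x)) (s : forall x, E x) (t : forall x, F x) (x : S)
    : Prop :=
  rsec t (i x) /\ \forall y \near x, t (i y) = iE y (s y).

Record complexification (GR : cartan S) (GC : cartan Sigma) := Complexification {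
  cx_map : S -> Sigma;
  cx_vec : forall x, cV GR x -> cV GC (cx_map x);
  cx_nonempty : exists x : S, True;
  cx_inj : injective cx_map;
  cx_top : forall A : set S, open A <-> exists2 B, open B & A = cx_map @^-1` B;
  cx_extends : forall x, exists H, extends cx_map x H;
  cx_add : forall x (v w : cV GR x), cx_vec (v + w) = cx_vec v + cx_vec w;
  cx_scale : forall x (a : R) (v : cV GR x), cx_vec (a *: v) = ((a%:C)%C : Cplx R) *: cx_vec v;
  cx_basis : forall x (b : 4.-tuple (cV GR x)), basis_of fullv b ->
    basis_of fullv [seq cx_vec v | v <- b];
  cx_met : forall x (v w : cV GR x), cmet (cx_vec v) (cx_vec w) = ((cmet v w)%:C)%C;
  cx_L : forall x v, v \in cL GR x -> cx_vec v \in cL GC (cx_map x);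
  cx_sec : forall x s, rsec s x -> exists t, sec_extends cx_vec s t x;
  cx_D : forall x H s t X, extends cx_map x H -> rsec s x ->
    sec_extends cx_vec s t x ->
    cD GC (cx_map x) ('d H (cplx_mx (cphi (chart_at x) x)) (cplx_mx X)) t =
      cx_vec (cD GR x X s) }.

End Complexification.

Definition simply_connected (R : realType) (X : topologicalType) (A : set X) : Prop :=
  let I := `[0, 1]%classic : set R in
  (forall x y, A x -> A y -> exists g : R -> X,
     [/\ {within I, continuous g}, forall t, I t -> A (g t), g 0 = x & g 1 = y]) /\
  (forall g : R -> X, {within I, continuous g} -> (forall t, I t -> A (g t)) ->
     g 0 = g 1 ->
     exists H : R * R -> X,
     [/\ {within I `*` I, continuous H},
         forall s t, I s -> I t -> A (H (s, t)),
         forall t, I t -> H (0, t) = g t,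
         forall t, I t -> H (1, t) = g 0 &
         forall s, I s -> H (s, 0) = g 0 /\ H (s, 1) = g 0]).

Section Leaves.
Variables (R : realType).
Notation C := (Cplx R).
Notation disc := (fun u : 'rV[C]_1 => `|u| < 1).
Variables (M : manifold (@holomorphic R) 2) (G : cartan M).

(* Two points are on the same leaf when they are joined by a chain of arcs,
   an arc being parametrised by the unit disc. *)
Definition same_leaf (X : Type) (arc : ('rV[C]_1 -> X) -> Prop) : X -> X -> Prop :=
  clos_refl_trans X (fun a b =>
    exists p u v, [/\ arc p, disc u, disc v, p u = a & p v = b]).

(* X lies in the line t with delta (L (x) t) = U / L *)
Definition null_direction (U : forall x, {vspace cV G x}) (x : M) (X : 'rV[C]_2) : Prop :=
  forall l, rsec_in (cL G) l x -> cD G x X l \in U x.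

Definition arc (U : forall x, {vspace cV G x}) (g : 'rV[C]_1 -> M) : Prop :=
  forall u, disc u ->
    [/\ mplot (M := M) g u, velocity g u != 0 & null_direction U (g u) (velocity g u)].

(* x and y are on the same integral curve *)
Definition same_curve (U : forall x, {vspace cV G x}) : M -> M -> Prop :=
  same_leaf (arc U).

Notation PV := {x : M & {vspace cV G x}}.

Definition PU (U : forall x, {vspace cV G x}) : set PV :=
  [set p | \dim (tagged p) = 1%N /\ (tagged p <= U (tag p))%VS].

Definition pt_of_L (x : M) : PV := existT _ x (cL G x).

Definition PVplot m (p : 'rV[C]_m -> PV) (u : 'rV[C]_m) : Prop :=
  exists v : 'rV[C]_m -> {x : M & cV G x}, bplot v u /\
    \forall w \near u, tagged (v w) != 0 /\
      p w = existT _ (tag (v w)) <[tagged (v w)]>%VS.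

(* horizontal lifts to P(U): locally along the arc, the line is spanned by a
   section which is D-parallel along the arc *)
Definition PU_arc (U : forall x, {vspace cV G x}) (p : 'rV[C]_1 -> PV) : Prop :=
  let g := fun u => tag (p u) in
  arc U g /\
  forall u, disc u -> PU U (p u) /\
    exists s, rsec s (g u) /\
      \forall v \near u, [/\ s (g v) != 0, tagged (p v) = <[s (g v)]>%VS &
        cD G (g v) (velocity g v) s = 0].

Variable (h : half G).

(* Utilde = U (x) A* (x) A*, where U = A (x) F; contracting A with A* this is
   F (x) A* = Hom(A, F), in which B (x) A* is the line of maps with values in B,
   and B (x) A*, A (x) B* are dual by composition. *)
Definition Ut (x : M) := 'Hom(subvs_of (hA h x), hF h x).
Notation TUt := {x : M & Ut x}.

Definition Ut_at (p : TUt) (a : hE h (tag p)) : hF h (tag p) :=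
  tagged p (vsproj (hA h (tag p)) a).

Definition Ut_zero (x : M) : TUt := existT Ut x 0.

Definition Ut_nonzero (p : TUt) : Prop := tagged p != 0.

Definition Ut_plot m (p : 'rV[C]_m -> TUt) (u : 'rV[C]_m) : Prop :=
  mplot (M := M) (fun v => tag (p v)) u /\
  forall s, rsec_in (hA h) s (tag (p u)) ->
    bplot (E := hF h) (fun v => existT _ (tag (p v)) (Ut_at (p := p v) (s (tag (p v))))) u.

(* P(Utilde) = P(U): the line of U corresponding to a nonzero vector of Utilde *)
Definition Ut_proj (p : TUt) : PV :=
  let a := vpick (hA h (tag p)) in
  existT _ (tag p) <[@hten _ _ _ _ h (tag p) a (Ut_at a)]>%VS.

(* horizontal lifts to Utilde: a homomorphism A -> F is parallel along the arc
   when it maps a parallel section of A to a parallel section of F *)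
Definition Ut_arc (p : 'rV[C]_1 -> TUt) : Prop :=
  let g := fun u => tag (p u) in
  arc (hU h) g /\
  forall u, disc u -> exists a s, [/\ rsec a (g u), rsec s (g u) &
    \forall v \near u,
      [/\ a (g v) \in hA h (g v), a (g v) != 0,
          Ut_at (p := p v) (a (g v)) = s (g v),
          hDE h (g v) (velocity g v) a = 0 & hDF h (g v) (velocity g v) s = 0]].

(* the line subbundle B (x) A* of Utilde, without its zero section *)
Definition Lstar : set TUt :=
  [set p | Ut_nonzero p /\ forall a, a \in hA h (tag p) -> Ut_at (p := p) a \in hB h (tag p)].

(* The leaf spaces and the restrictions on Sigma, for one of the two families of
   curves.  [c] is the chosen curve of the other family. *)
Record leaf_spaces (c : set M) := LeafSpaces {
  lC : manifold (@holomorphic R) 1;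
  lT : manifold (@holomorphic R) 2;
  lV : manifold (@holomorphic R) 3;
  qC : M -> lC;
  qT : PV -> lT;
  qV : TUt -> lV;
  lC_hausdorff : hausdorff_space lC;
  lT_hausdorff : hausdorff_space lT;
  lV_hausdorff : hausdorff_space lV;
  qC_quotient : quotient_map (@mplot _ _ _ M) setT qC (same_curve (hU h));
  qT_quotient : quotient_map PVplot (PU (hU h)) qT (same_leaf (PU_arc (hU h)));
  qV_quotient : quotient_map Ut_plot setT qV (same_leaf Ut_arc);
  curves_simply_connected : forall x, simply_connected R [set y | same_curve (hU h) x y];
  (* a leaf meets each fibre at most once *)
  qT_fibre : forall x l l', PU (hU h) (existT _ x l) -> PU (hU h) (existT _ x l') ->
    qT (existT _ x l) = qT (existT _ x l') -> l = l';
  qV_fibre : forall x (v v' : Ut x),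
    qV (existT _ x v) = qV (existT _ x v') -> v = v';
  (* a leaf meets P(L), resp. Lstar, at most once *)
  qT_L : forall x y, qT (pt_of_L x) = qT (pt_of_L y) -> x = y;
  qV_L : forall p p', Lstar p -> Lstar p' -> qV p = qV p' -> p = p';
  (* the leaf spaces are identified with the restrictions to c *)
  qT_c : forall t, exists! p, [/\ PU (hU h) p, c (tag p) & qT p = t];
  qV_c : forall v, exists! p, c (tag p) /\ qV p = v }.

Variables (c : set M) (l : leaf_spaces c).

Definition zero_section : set (lV l) :=
  [set v | exists2 x, c x & v = qV l (Ut_zero x)].

Definition Wspace : set (lV l) :=
  zero_section `|` [set v | exists2 p, Lstar p & v = qV l p].

(* disc-like in the fibres: every complex line through 0 in a fibre meets B in
   a disc centred at 0 (or is contained in B) *)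
Definition tubular (B : set (lV l)) : Prop :=
  [/\ open B, zero_section `<=` B &
      forall x (v : Ut x) (a : C), c x -> `|a| <= 1 ->
        B (qV l (existT _ x v)) -> B (qV l (existT _ x (a *: v)))].

Definition Zspace (B : set (lV l)) : set (lV l) := B `|` Wspace.

End Leaves.

Arguments zero_section {R M G h c} l.

Section Gluing.
Variables (R : realType) (M : manifold (@holomorphic R) 2) (G : cartan M).
Variables (U : null_planes G) (s : spinors U).
Notation hp := (half_plus s).
Notation hm := (half_minus s).
Variables (cp cm : set M) (lp : leaf_spaces hp cm) (lm : leaf_spaces hm cp).

(* as subsets of P(V), the two leaves meet exactly in the point P(L)_x *)
Definition T_rel (sp : lT lp) (sm : lT lm) : Prop :=
  exists x, [set p | PU (Up U) p /\ qT lp p = sp] `&`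
            [set p | PU (Um U) p /\ qT lm p = sm] = [set pt_of_L G x].

Definition Z_rel (vp : lV lp) (vm : lV lm) : Prop :=
  exists x (a : Ut hp x) (b : Ut hm x),
  [/\ [set p | qV lp p = vp] `&` @Lstar _ _ _ hp = [set existT _ x a],
      [set p | qV lm p = vm] `&` @Lstar _ _ _ hm = [set existT _ x b] &
      (* the dual pairing of a and b is 1 *)
      forall w, w \in sLp s x ->
        Ut_at (h := hm) (p := existT _ x b) (Ut_at (h := hp) (p := existT _ x a) w) = w].

Definition small_tubes (Bp : set (lV lp)) (Bm : set (lV lm)) : Prop :=
  forall vp vm, Bp vp -> Z_rel vp vm -> ~ Bm vm.

Definition is_T (T : manifold (@holomorphic R) 2) (jp : lT lp -> T) (jm : lT lm -> T) : Prop :=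
  is_gluing setT setT T_rel jp jm.

Definition is_Z (Bp : set (lV lp)) (Bm : set (lV lm))
    (Z : manifold (@holomorphic R) 3) (ip : lV lp -> Z) (im : lV lm -> Z) : Prop :=
  is_gluing (Zspace Bp) (Zspace Bm) Z_rel ip im.

Definition nonzero_part (Z : manifold (@holomorphic R) 3)
    (ip : lV lp -> Z) (im : lV lm -> Z) : set Z :=
  ~` (ip @` zero_section lp `|` im @` zero_section lm).

(* Pi is induced by v |-> [v] on the restrictions of Utilde+- to c_0^-+ *)
Definition is_projection (Bp : set (lV lp)) (Bm : set (lV lm))
    (Z : manifold (@holomorphic R) 3) (ip : lV lp -> Z) (im : lV lm -> Z)
    (T : manifold (@holomorphic R) 2) (jp : lT lp -> T) (jm : lT lm -> T)
    (Pi : Z -> T) : Prop :=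
  (forall p, cm (tag p) -> Ut_nonzero p -> Zspace Bp (qV lp p) ->
     Pi (ip (qV lp p)) = jp (qT lp (Ut_proj p))) /\
  (forall p, cp (tag p) -> Ut_nonzero p -> Zspace Bm (qV lm p) ->
     Pi (im (qV lm p)) = jm (qT lm (Ut_proj p))).

End Gluing.

(* Main.v *)
From HB Require Import structures.
From Stdlib Require Import Eqdep_dec.
Require Import Defs.
Import Order.TTheory GRing.Theory Num.Theory.
Import numFieldNormedType.Exports.
Local Open Scope classical_set_scope.
Local Open Scope ring_scope.

Set Implicit Arguments.
Unset Strict Implicit.
Unset Printing Implicit Defensive.

(* Multiplication by k on the fibres of U~+ and U~- commutes with horizontal
   lifts, hence acts on the leaf spaces V+ and V-.  Since the gluing of Z matches
   l with its dual l*, the action of k on V+ and of k^-1 on V- agree on the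
   overlap, which lies in the scaling-invariant sets W+ and W-; the action is
   defined wherever z and k z lie in a common one of the two pieces of Z.
   Projectivisation sends leaves in U~ to leaves in P(U), and two nonzero leaves
   with the same image differ by a scalar: compare them in a fibre over the
   transverse curve c.  A leaf of V+ and one of V- with the same image in T pass
   through P(L)_x for a common x, so they are multiples of the leaf of some l in
   L+ and of that of its dual l*, which are identified in Z. *)

(** * Holomorphic calculus *)

(** The leaf spaces are known only as quotients, so regularity on them is checked upstairs: a plot
    is lifted to the bundle through the local sections that a quotient map provides, treated there
    in frames, and pushed down again. The delicate point is that [Pi] is a submersion. A local
    section of the quotient onto [lT] is a family of lines in U = A (x) F, spanned by some regular
    vector along the plot. To turn it into a family of homomorphisms A -> F, the factor in F must be
    split off regularly; this is done by pairing with frame vectors through the metric, which is a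
    product of two nondegenerate forms. Leaves of zero vectors must stay apart from the others. This
    needs no uniqueness theorem for parallel transport: it follows from linearity and from leaves
    meeting each fibre at most once. On Z the action starts as a relation, the union of two partial
    scalings, and single-valuedness is proved afterwards. *)

Lemma near_eq_differentiable (K : numFieldType) (V W : normedModType K)
    (f g : V -> W) (x : V) :
  (\forall y \near x, f y = g y) -> differentiable f x -> differentiable g x.
Proof.
move=> fg df.
(* [g] is [f] plus [g - f], which vanishes near [x]; such a function has differential zero by
   uniqueness of the first order expansion. *)
have d0 (h : V -> W) : (\forall y \near x, h y = 0) -> differentiable h x.
  move=> h0.
  have hx : h x = 0 by apply: (nbhs_singleton h0).
  have E : h \o shift x = cst (h x) + \0 +o_ (0 : V) id.
    apply/eqaddoP => _/posnumP[e].
    have : \forall y \near (0 : V), h (y + x) = 0.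
      by have := h0; rewrite (near_shift 0) /=; apply: filterS => y /=; rewrite subr0.
    apply: filterS => y hy /=.
    rewrite -fctE !fctE /= hx addr0 subr0 hy normr0.
    by apply: mulr_ge0.
  have E0 : 'd h x = 0 :> (V -> W).
    by apply/diff_unique; [move=> y; exact: cst_continuous | exact: E].
  by apply/diff_locallyP; rewrite E0; split=> // y; exact: cst_continuous.
rewrite (_ : g = f + (g - f)); last by apply/funext => y; rewrite !fctE addrC subrK.
apply: differentiableD => //; apply: d0.
by apply: filterS fg => y; rewrite !fctE => ->; rewrite subrr.
Qed.

Lemma continuous_near (X Y : topologicalType) (f : X -> Y) (x : X) (P : set Y) :
  {for x, continuous f} -> (\forall y \near f x, P y) -> \forall v \near x, P (f v).
Proof. by move=> cf Py; exact: (cf _ Py). Qed.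

Lemma near_eq_continuous (X Y : topologicalType) (f g : X -> Y) (x : X) :
  (\forall y \near x, f y = g y) -> {for x, continuous f} -> {for x, continuous g}.
Proof.
move=> fg cf A; rewrite -(nbhs_singleton fg) => /cf hA.
have {}hA : \forall y \near x, A (f y) by [].
by change (\forall y \near x, A (g y)); apply: filterS2 hA fg => v + <-.
Qed.

Lemma near_neq (K : numFieldType) (a b : K) : a != b -> \forall x \near a, x != b.
Proof.
move=> ab; have ob : open (~` [set b]).
  apply/closed_openC/accessible_closed_set1/hausdorff_accessible.
  exact: norm_hausdorff.
have : nbhs a (~` [set b]) by apply: open_nbhs_nbhs; split => //; exact/eqP.
by apply: filterS => x /eqP.
Qed.

Section Holomorphic.
Variable R : realType.
Notation C := (Cplx R).

Lemma holomorphic_near_eq m n (f g : 'rV[C]_m -> 'rV[C]_n) u :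
  (\forall v \near u, f v = g v) -> holomorphic f u -> holomorphic g u.
Proof.
move=> /near_join fg; apply: filterS2 fg => v; exact: near_eq_differentiable.
Qed.

Lemma holomorphic_continuous m n (f : 'rV[C]_m -> 'rV[C]_n) u :
  holomorphic f u -> {for u, continuous f}.
Proof. by move=> /nbhs_singleton; apply: differentiable_continuous. Qed.

Lemma holomorphic_comp m n p (f : 'rV[C]_m -> 'rV[C]_n) (g : 'rV[C]_n -> 'rV[C]_p) u :
  holomorphic f u -> holomorphic g (f u) -> holomorphic (g \o f) u.
Proof.
move=> hf hg.
have hgf : \forall v \near u, differentiable g (f v).
  exact: (holomorphic_continuous hf hg).
near=> v; apply: differentiable_comp; near: v; [exact: hf | exact: hgf].
Unshelve. all: by end_near.
Qed.

Lemma holomorphic_id m (u : 'rV[C]_m) : holomorphic id u.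
Proof. by apply: filterE => v; apply: ex_diff. Qed.

(** Scalars are seen as rows of length one, the form in which [rfun] and [bplot] state
    regularity. *)
Definition sreg m (f : 'rV[C]_m -> C) u :=
  holomorphic (fun v => const_mx (f v) : 'rV[C]_1) u.

Lemma sregP m (f : 'rV[C]_m -> C) u :
  sreg f u <-> \forall v \near u, differentiable f v.
Proof.
split; apply: filterS => v fv.
  have -> : f = (fun w : 'rV[C]_1 => w 0 0) \o (fun v => const_mx (f v)).
    by apply/funext => w /=; rewrite mxE.
  by apply: differentiable_comp fv _; apply: differentiable_coord.
have -> : (fun v => const_mx (f v) : 'rV[C]_1) = (fun v => f v *: const_mx 1).
  by apply/funext => w; apply/rowP => j; rewrite !mxE mulr1.
exact: differentiableZl.
Qed.

Lemma sreg_coords m n (f : 'rV[C]_m -> 'rV[C]_n) u :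
  (forall j, sreg (fun v => f v 0 j) u) -> holomorphic f u.
Proof.
move=> hf.
have -> : f = \sum_j (fun v => f v 0 j *: (delta_mx 0 j : 'rV[C]_n)).
  by apply/funext => v; rewrite fct_sumE [LHS]row_sum_delta.
have hj j : \forall v \near u, differentiable (fun w => f w 0 j) v by exact/sregP/hf.
apply: filterS (@filter_forall _ _ _ (nbhs u) _ hj) => v hv.
by apply: differentiable_sum => j; exact: differentiableZl.
Qed.

Lemma holomorphic_coord m n (f : 'rV[C]_m -> 'rV[C]_n) u j :
  holomorphic f u -> sreg (fun v => f v 0 j) u.
Proof.
move=> hf; apply/sregP; apply: filterS hf => v fv.
have -> : (fun v => f v 0 j) = (fun w : 'rV[C]_n => w 0 j) \o f by [].
by apply: differentiable_comp fv _; apply: differentiable_coord.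
Qed.

Lemma sreg_near m (f : 'rV[C]_m -> C) u : sreg f u -> \forall v \near u, sreg f v.
Proof. exact: near_join. Qed.

Lemma sreg_near_eq m (f g : 'rV[C]_m -> C) u :
  (\forall v \near u, f v = g v) -> sreg f u -> sreg g u.
Proof. by move=> fg; apply: holomorphic_near_eq; apply: filterS fg => v ->. Qed.

Lemma sreg_comp m n (f : 'rV[C]_m -> 'rV[C]_n) (g : 'rV[C]_n -> C) u :
  holomorphic f u -> sreg g (f u) -> sreg (fun v => g (f v)) u.
Proof. exact: holomorphic_comp. Qed.

Lemma sreg_continuous m (f : 'rV[C]_m -> C) u : sreg f u -> {for u, continuous f}.
Proof. by move=> /sregP/nbhs_singleton; apply: differentiable_continuous. Qed.

Lemma sreg_cst m (c : C) (u : 'rV[C]_m) : sreg (fun _ => c) u.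
Proof. by apply/sregP; apply: filterE => v; apply: differentiable_cst. Qed.

Lemma sregD m (f g : 'rV[C]_m -> C) u :
  sreg f u -> sreg g u -> sreg (fun v => f v + g v) u.
Proof.
move=> /sregP hf /sregP hg; apply/sregP; apply: filterS2 hf hg => v.
exact: differentiableD.
Qed.

Lemma sregM m (f g : 'rV[C]_m -> C) u :
  sreg f u -> sreg g u -> sreg (fun v => f v * g v) u.
Proof.
move=> /sregP hf /sregP hg; apply/sregP; apply: filterS2 hf hg => v.
exact: differentiableM.
Qed.

Lemma sregV m (f : 'rV[C]_m -> C) u :
  f u != 0 -> sreg f u -> sreg (fun v => (f v)^-1) u.
Proof.
move=> fu0 hf; have /sregP hf' := hf; apply/sregP.
have f0 : \forall v \near u, f v != 0.
  exact: (sreg_continuous hf (near_neq fu0)).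
apply: filterS2 hf' f0 => v; exact: differentiableV.
Qed.

Lemma sreg_sum m (I : Type) (r : seq I) (f : I -> 'rV[C]_m -> C) u :
  (forall i, sreg (f i) u) -> sreg (fun v => \sum_(i <- r) f i v) u.
Proof.
move=> hf; elim: r => [|i r IH].
  by rewrite (_ : (fun _ => _) = fun _ => 0);
    [exact: sreg_cst | apply/funext => v; rewrite big_nil].
rewrite (_ : (fun _ => _) = fun v => f i v + \sum_(j <- r) f j v); first exact: sregD.
by apply/funext => v; rewrite big_cons.
Qed.

End Holomorphic.

(** * Complex manifolds *)

Section ComplexManifolds.
Variable R : realType.
Notation C := (Cplx R).
Notation mfd := (manifold (@holomorphic R)).

Section Charts.
Variables (n : nat) (M : mfd n) (c : chart C M n) (x : M).
Hypotheses (ac : atlas M c) (cx : cdom c x).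

Lemma near_cdom : \forall y \near x, cdom c y.
Proof. by have [oc _ _ _ _] := atlasP ac; apply: open_nbhs_nbhs. Qed.

Lemma cphi_continuous : {for x, continuous (cphi c)}.
Proof.
have [oc _ _ cf _] := atlasP ac.
by move: cf; rewrite continuous_open_subspace // => /(_ x); apply; rewrite inE.
Qed.

Lemma cpsi_continuous : {for cphi c x, continuous (cpsi c)}.
Proof.
have [_ oc _ _ cf] := atlasP ac.
move: cf; rewrite continuous_open_subspace // => /(_ (cphi c x)); apply.
by rewrite inE; exists x.
Qed.

Lemma cphiK y : cdom c y -> cpsi c (cphi c y) = y.
Proof. by have [_ _ K _ _] := atlasP ac; apply: K. Qed.

Lemma near_cphiK : \forall y \near x, cpsi c (cphi c y) = y.
Proof. by apply: filterS near_cdom => y; apply: cphiK. Qed.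

End Charts.

Section Plots.
Variables (n : nat) (M : mfd n).

Lemma mplot_continuous m (p : 'rV[C]_m -> M) u : mplot (M := M) p u -> {for u, continuous p}.
Proof. by case. Qed.

Lemma mplot_near_eq m (p q : 'rV[C]_m -> M) u :
  (\forall v \near u, p v = q v) -> mplot (M := M) p u -> mplot (M := M) q u.
Proof.
move=> pq [cp hp]; have pqu := nbhs_singleton pq.
split=> [|c ac cu].
  exact: near_eq_continuous pq cp.
apply: holomorphic_near_eq _ (hp c ac _); last by rewrite pqu.
by apply: filterS pq => v /= ->.
Qed.

Lemma mplot_cst m (x : M) (u : 'rV[C]_m) : mplot (M := M) (fun _ => x) u.
Proof.
split=> [|c _ _]; first exact: cst_continuous.
by apply: sreg_coords => j; exact: sreg_cst.
Qed.

Lemma mplot_precomp m k (h : 'rV[C]_k -> 'rV[C]_m) (p : 'rV[C]_m -> M) u :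
  holomorphic h u -> mplot (M := M) p (h u) -> mplot (M := M) (p \o h) u.
Proof.
move=> hh [cp hp]; split=> [|c ac cu].
  by apply: continuous_comp => //; exact: holomorphic_continuous.
exact: (holomorphic_comp hh (hp c ac cu)).
Qed.

Lemma mplot_cpsi c x : atlas M c -> cdom c x -> mplot (M := M) (cpsi c) (cphi c x).
Proof.
move=> ac cx; split=> [|c' ac']; first exact: cpsi_continuous.
by rewrite (cphiK ac cx) => cx'; apply: atlas_compat.
Qed.

End Plots.

Lemma rmap_mplot m n k (M : mfd n) (N : mfd k) (f : M -> N) (p : 'rV[C]_m -> M) u :
  rmap f (p u) -> mplot (M := M) p u -> mplot (M := N) (f \o p) u.
Proof.
move=> rf [cp hp]; have [ac cu] := chart_atP (p u).
set c := chart_at (p u) in ac cu.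
have := mplot_precomp (hp c ac cu) (rf c ac cu).
apply: mplot_near_eq.
have : \forall v \near u, cdom c (p v) by exact: (cp _ (near_cdom ac cu)).
by apply: filterS => v cv /=; rewrite (cphiK ac).
Qed.

Lemma rmap_continuous n k (M : mfd n) (N : mfd k) (f : M -> N) x :
  rmap f x -> {for x, continuous f}.
Proof.
move=> rf; have [ac cx] := chart_atP x; set c := chart_at x in ac cx.
have cf := (rf c ac cx).1; have cc := cphi_continuous ac cx.
apply: (@near_eq_continuous _ _ ((f \o cpsi c) \o cphi c)).
  by apply: filterS (near_cphiK ac cx) => y /= ->.
exact: continuous_comp.
Qed.

Section Functions.
Variables (n : nat) (M : mfd n).

Lemma rfun_mplot m (f : M -> C) (p : 'rV[C]_m -> M) u :
  rfun f (p u) -> mplot (M := M) p u -> sreg (fun v => f (p v)) u.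
Proof.
move=> rf [cp hp]; have [ac cu] := chart_atP (p u).
set c := chart_at (p u) in ac cu.
apply: sreg_near_eq _ (sreg_comp (hp c ac cu) (rf c ac cu)).
have : \forall v \near u, cdom c (p v) by exact: (cp _ (near_cdom ac cu)).
by apply: filterS => v cv /=; rewrite (cphiK ac).
Qed.

(** Transition maps are holomorphic, so one chart decides for all; this is what makes [rfun] an open
    condition. *)
Lemma rfun_one_chart (f : M -> C) x c : atlas M c -> cdom c x ->
  sreg (fun u => f (cpsi c u)) (cphi c x) -> rfun f x.
Proof.
move=> ac cx hf c' ac' cx'.
have := holomorphic_comp (atlas_compat ac' ac cx' cx).
rewrite /= (cphiK ac' cx') => /(_ _ _ hf).
apply: holomorphic_near_eq => /=.
have : \forall v \near cphi c' x, cdom c (cpsi c' v).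
  by apply: (mplot_cpsi ac' cx').1; rewrite (cphiK ac' cx'); apply: near_cdom.
by apply: filterS => v cv; rewrite (cphiK ac).
Qed.

Lemma rfun_near (f : M -> C) x : rfun f x -> \forall y \near x, rfun f y.
Proof.
move=> rf; have [ac cx] := chart_atP x; set c := chart_at x in ac cx.
have : \forall y \near x, sreg (fun u => f (cpsi c u)) (cphi c y).
  apply: (@continuous_near _ _ (cphi c) x (sreg (fun u => f (cpsi c u)))).
    exact: cphi_continuous.
  exact: sreg_near (rf c ac cx).
by apply: filterS2 (near_cdom ac cx) => y cy; apply: rfun_one_chart.
Qed.

Lemma rfun_near_eq (f g : M -> C) x :
  (\forall y \near x, f y = g y) -> rfun f x -> rfun g x.
Proof.
move=> fg rf c ac cx; apply: sreg_near_eq _ (rf c ac cx).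
apply: (@continuous_near _ _ _ _ (fun y => f y = g y) (mplot_cpsi ac cx).1).
by rewrite (cphiK ac cx).
Qed.

Lemma rfun_continuous (f : M -> C) x : rfun f x -> {for x, continuous f}.
Proof.
move=> rf; have [ac cx] := chart_atP x; set c := chart_at x in ac cx.
have cf := sreg_continuous (rf c ac cx); have cc := cphi_continuous ac cx.
apply: (@near_eq_continuous _ _ ((f \o cpsi c) \o cphi c)).
  by apply: filterS (near_cphiK ac cx) => y /= ->.
exact: continuous_comp.
Qed.

Lemma rfun_cst (a : C) (x : M) : rfun (fun _ => a) x.
Proof. by move=> c _ _; exact: sreg_cst. Qed.

Lemma rfunM (f g : M -> C) x : rfun f x -> rfun g x -> rfun (fun y => f y * g y) x.
Proof. by move=> hf hg c ac cx; apply: sregM; [exact: hf | exact: hg]. Qed.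

Lemma rfunV (f : M -> C) x : f x != 0 -> rfun f x -> rfun (fun y => (f y)^-1) x.
Proof.
by move=> f0 hf c ac cx; apply: sregV; [rewrite (cphiK ac cx) | exact: hf].
Qed.

Lemma rfun_sum I (r : seq I) (f : I -> M -> C) x :
  (forall i, rfun (f i) x) -> rfun (fun y => \sum_(i <- r) f i y) x.
Proof. by move=> hf c ac cx; apply: sreg_sum => i; exact: hf. Qed.

Lemma dfun_cst (a : C) (x : M) X : dfun (fun _ => a) x X = 0.
Proof.
rewrite /dfun (_ : (fun _ => _) = cst (const_mx a : 'rV[C]_1)) //.
by rewrite diff_cst mxE.
Qed.

End Functions.
End ComplexManifolds.

(** * Bundles *)

Lemma linear_sumZ (K : fieldType) (V W : lmodType K) (f : V -> W) I (r : seq I)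
    (a : I -> K) (v : I -> V) :
  linear f -> f (\sum_(i <- r) a i *: v i) = \sum_(i <- r) a i *: f (v i).
Proof.
move=> lf; have f0 : f 0 = 0 by have := lf (-1) 0 0; rewrite scaler0 addr0 scaleN1r addNr.
by elim: r => [|i r IH]; rewrite ?big_nil // !big_cons lf IH.
Qed.

Lemma scalar_sumZ (K : fieldType) (V : lmodType K) (f : V -> K) I (r : seq I)
    (a : I -> K) (v : I -> V) :
  scalar f -> f (\sum_(i <- r) a i *: v i) = \sum_(i <- r) a i * f (v i).
Proof.
move=> lf; have f0 : f 0 = 0 by have := lf (-1) 0 0; rewrite scaler0 addr0 mulN1r addNr.
by elim: r => [|i r IH]; rewrite ?big_nil // !big_cons lf IH.
Qed.

Section ComplexBundles.
Variables (R : realType) (n : nat) (M : manifold (@holomorphic R) n).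
Notation C := (Cplx R).

Section OneBundle.
Variables (k : nat) (E : vbundle M k).

Lemma frame_expand e x (v : E x) : frames E e -> fdom e x ->
  v = \sum_i coord (fvec e x) i v *: tnth (fvec e x) i.
Proof.
move=> fe ex; have [_ /(_ x ex) be] := framesP fe.
rewrite {1}(coord_basis be (memvf v)).
by apply: eq_bigr => i _; rewrite (tnth_nth 0).
Qed.

Lemma near_fdom e x : frames E e -> fdom e x -> \forall y \near x, fdom e y.
Proof. by move=> fe ex; have [oe _] := framesP fe; apply: open_nbhs_nbhs. Qed.

Lemma coord_change (e e' : frame E k) x (v : E x) j : frames E e -> fdom e x ->
  coord (fvec e' x) j v =
  \sum_i coord (fvec e x) i v * coord (fvec e' x) j (tnth (fvec e x) i).
Proof.
move=> fe ex; rewrite {1}(frame_expand v fe ex).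
by rewrite (scalar_sumZ _ _ _ (linearP _)).
Qed.

(* [bplot], with the plot of the base and the vectors along it separated *)
Definition fplot m (g : 'rV[C]_m -> M) (f : forall v, E (g v)) (u : 'rV[C]_m) : Prop :=
  mplot (M := M) g u /\ forall e, frames E e -> fdom e (g u) ->
    forall i, sreg (fun v => coord (fvec e (g v)) i (f v)) u.

Lemma rsec_one_frame (s : forall x, E x) x e : frames E e -> fdom e x ->
  (forall i, rfun (fun y => coord (fvec e y) i (s y)) x) -> rsec s x.
Proof.
move=> fe ex hs e' fe' ex' j.
have : rfun (fun y => \sum_i coord (fvec e y) i (s y) *
    coord (fvec e' y) j (tnth (fvec e y) i)) x.
  apply: rfun_sum => i; apply: rfunM; first exact: hs.
  exact: frames_compat.
apply: rfun_near_eq.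
by apply: filterS (near_fdom fe ex) => y ey; rewrite -coord_change.
Qed.

(** The Leibniz rules ask for regularity at every point where a derivative is taken, while [Ut_arc]
    supplies it only at [g u]; openness bridges the gap. *)
Lemma rsec_near (s : forall x, E x) x : rsec s x -> \forall y \near x, rsec s y.
Proof.
move=> hs; have [e fe ex] := frames_cover E x.
have H i : \forall y \near x, rfun (fun y => coord (fvec e y) i (s y)) y.
  exact: rfun_near (hs e fe ex i).
apply: filterS2 (near_fdom fe ex) (@filter_forall _ _ _ (nbhs x) _ H) => y ey.
exact: rsec_one_frame.
Qed.

Lemma rsec_frame e x i : frames E e -> fdom e x ->
  rsec (fun y => tnth (fvec e y) i) x.
Proof. by move=> fe ex e' fe' ex' j; apply: frames_compat. Qed.

Lemma rsecZ (f : M -> C) (s : forall x, E x) x :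
  rfun f x -> rsec s x -> rsec (fun y => f y *: s y) x.
Proof.
move=> hf hs e fe ex i.
apply: (rfun_near_eq _ (rfunM hf (hs e fe ex i))).
by apply: filterE => y; rewrite linearZ.
Qed.

Lemma rsec_fplot m (g : 'rV[C]_m -> M) (s : forall x, E x) u :
  rsec s (g u) -> mplot (M := M) g u -> fplot (fun v => s (g v)) u.
Proof.
move=> hs pg; split=> // e fe eu i.
exact: (@rfun_mplot _ _ _ _ (fun y => coord (fvec e y) i (s y)) _ _ (hs e fe eu i) pg).
Qed.

Lemma fplot_near_eq m (g : 'rV[C]_m -> M) (f f' : forall v, E (g v)) u :
  (\forall v \near u, f v = f' v) -> fplot f u -> fplot f' u.
Proof.
move=> ff' [pg hf]; split=> // e fe eu i.
by apply: (sreg_near_eq _ (hf e fe eu i)); apply: filterS ff' => v ->.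
Qed.

Lemma fplotZ m (g : 'rV[C]_m -> M) (f : forall v, E (g v)) (a : 'rV[C]_m -> C) u :
  sreg a u -> fplot f u -> fplot (fun v => a v *: f v) u.
Proof.
move=> ha [pg hf]; split=> // e fe eu i.
apply: (sreg_near_eq _ (sregM ha (hf e fe eu i))).
by apply: filterE => y; rewrite linearZ.
Qed.

Lemma fplotD m (g : 'rV[C]_m -> M) (f f' : forall v, E (g v)) u :
  fplot f u -> fplot f' u -> fplot (fun v => f v + f' v) u.
Proof.
move=> [pg hf] [_ hf']; split=> // e fe eu i.
apply: (sreg_near_eq _ (sregD (hf e fe eu i) (hf' e fe eu i))).
by apply: filterE => y; rewrite linearD.
Qed.

Lemma fplot_cst m (x : M) (w : E x) (u : 'rV[C]_m) : @fplot m (fun _ => x) (fun _ => w) u.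
Proof. by split=> [|e fe eu i]; [exact: mplot_cst | exact: sreg_cst]. Qed.

Lemma fplot_near_neq0 m (g : 'rV[C]_m -> M) (f : forall v, E (g v)) u :
  fplot f u -> f u != 0 -> \forall v \near u, f v != 0.
Proof.
move=> [pg hf] fu; have [e fe eu] := frames_cover E (g u).
have [i fi] : exists i, coord (fvec e (g u)) i (f u) != 0.
  apply/existsP; apply: contraNT fu; rewrite negb_exists => /forallP H.
  rewrite (frame_expand (f u) fe eu) big1 // => i _.
  by have := H i; rewrite negbK => /eqP ->; rewrite scale0r.
have := @continuous_near _ _ _ _ (fun z : C => z != 0)
  (sreg_continuous (hf e fe eu i)) (near_neq fi).
by apply: filterS => v; apply: contraNneq => ->; rewrite linear0.
Qed.

End OneBundle.

(** A bilinear product is known to be regular on sections only. Vectors along a plot need not come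
    from sections, so they are expanded in local frames, whose products are sections pulled back
    along the plot. *)
Lemma fplot_bilinear_product k1 k2 k3 (E1 : vbundle M k1) (E2 : vbundle M k2)
    (E3 : vbundle M k3) (b : forall x, E1 x -> E2 x -> E3 x) m (g : 'rV[C]_m -> M)
    (f1 : forall v, E1 (g v)) (f2 : forall v, E2 (g v)) u :
  bilinear_product b -> fplot f1 u -> fplot f2 u ->
  fplot (fun v => b (g v) (f1 v) (f2 v)) u.
Proof.
move=> [lr ll br] [pg h1] [_ h2]; split=> // e fe eu l.
have [e1 fe1 eu1] := frames_cover E1 (g u).
have [e2 fe2 eu2] := frames_cover E2 (g u).
have H i j : sreg (fun v => coord (fvec e (g v)) l
    (b (g v) (tnth (fvec e1 (g v)) i) (tnth (fvec e2 (g v)) j))) u.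
  have := br _ _ _ (rsec_frame i fe1 eu1) (rsec_frame j fe2 eu2) e fe eu l.
  by move=> /rfun_mplot; apply.
have : sreg (fun v => \sum_i coord (fvec e1 (g v)) i (f1 v) *
   \sum_j coord (fvec e2 (g v)) j (f2 v) * coord (fvec e (g v)) l
    (b (g v) (tnth (fvec e1 (g v)) i) (tnth (fvec e2 (g v)) j))) u.
  apply: sreg_sum => i; apply: sregM; first exact: h1.
  by apply: sreg_sum => j; apply: sregM; [exact: h2 | exact: H].
apply: sreg_near_eq.
apply: filterS2 (@continuous_near _ _ _ _ (fdom e1) pg.1 (near_fdom fe1 eu1))
  (@continuous_near _ _ _ _ (fdom e2) pg.1 (near_fdom fe2 eu2)) => v ev1 ev2.
rewrite {2}(frame_expand (f1 v) fe1 ev1) (linear_sumZ _ _ _ (ll _ _)).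
rewrite (scalar_sumZ _ _ _ (linearP _)); apply: eq_bigr => i _; congr (_ * _).
rewrite {2}(frame_expand (f2 v) fe2 ev2) (linear_sumZ _ _ _ (lr _ _)).
by rewrite (scalar_sumZ _ _ _ (linearP _)).
Qed.

Lemma sreg_bilinear_form k (E : vbundle M k) (b : forall x, E x -> E x -> C) m
    (g : 'rV[C]_m -> M) (f1 f2 : forall v, E (g v)) u :
  bilinear_form b -> fplot f1 u -> fplot f2 u ->
  sreg (fun v => b (g v) (f1 v) (f2 v)) u.
Proof.
move=> [lr ll br] [pg h1] [_ h2].
have [e fe eu] := frames_cover E (g u).
have H i j : sreg (fun v => 
    b (g v) (tnth (fvec e (g v)) i) (tnth (fvec e (g v)) j)) u.
  have := br _ _ _ (rsec_frame i fe eu) (rsec_frame j fe eu).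
  by move=> /rfun_mplot; apply.
have : sreg (fun v => \sum_i coord (fvec e (g v)) i (f1 v) *
   \sum_j coord (fvec e (g v)) j (f2 v) *
    b (g v) (tnth (fvec e (g v)) i) (tnth (fvec e (g v)) j)) u.
  apply: sreg_sum => i; apply: sregM; first exact: h1.
  by apply: sreg_sum => j; apply: sregM; [exact: h2 | exact: H].
apply: sreg_near_eq.
apply: filterS (@continuous_near _ _ _ _ (fdom e) pg.1 (near_fdom fe eu)) => v ev.
rewrite {2}(frame_expand (f1 v) fe ev) (scalar_sumZ _ _ _ (ll _ _)).
apply: eq_bigr => i _; congr (_ * _).
by rewrite {2}(frame_expand (f2 v) fe ev) (scalar_sumZ _ _ _ (lr _ _)).
Qed.

End ComplexBundles.

(** * The bundle of homomorphisms and its projectivisation *)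

(** The base is an [eqType], so equality proofs between its points are unique and the fibre
    component of a dependent pair can be read off. *)
Lemma existT_eq (T : eqType) (P : T -> Type) (x : T) (u v : P x) :
  existT P x u = existT P x v -> u = v.
Proof. by apply: inj_pair2_eq_dec; exact: eq_comparable. Qed.

Lemma vlineZ (K : fieldType) (V : vectType K) (k : K) (v : V) :
  k != 0 -> <[k *: v]>%VS = <[v]>%VS.
Proof.
move=> k0; apply/eqP; rewrite eqEsubv -!memvE memvZ ?memv_line //=.
by apply/vlineP; exists k^-1; rewrite scalerA mulVf // scale1r.
Qed.

Lemma vline_eq (K : fieldType) (V : vectType K) (v w : V) :
  w \in <[v]>%VS -> w != 0 -> <[v]>%VS = <[w]>%VS.
Proof.
by case/vlineP=> k ->; rewrite scaler_eq0 negb_or => /andP[k0 _]; rewrite vlineZ.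
Qed.

Section Half.
Variables (R : realType) (M : manifold (@holomorphic R) 2) (G : cartan M).
Notation C := (Cplx R).

(** What the two halves share once [W] and [Wh] are exchanged. The forms are parameters because
    [half] does not carry them. Everything about leaves is derived from this record and so serves
    both signs. *)
Record spinorial (h : half G) (eE : forall x, hE h x -> hE h x -> C)
    (eF : forall x, hF h x -> hF h x -> C) : Prop := Spinorial {
  sp_ten : bilinear_product (@hten _ _ _ _ h);
  sp_eE : bilinear_form eE;
  sp_eE_nondeg : nondegenerate eE;
  sp_eF : bilinear_form eF;
  sp_eF_alt : forall x (f : hF h x), eF x f f = 0;
  sp_eF_nondeg : nondegenerate eF;
  sp_met : forall x (a a' : hE h x) (f f' : hF h x),
    cmet (hten a f) (hten a' f') = eE x a a' * eF x f f';
  sp_D : forall x X s t, rsec s x -> rsec t x ->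
    cD G x X (fun y => hten (s y) (t y)) =
      hten (hDE h x X s) (t x) + hten (s x) (hDF h x X t);
  sp_A : subbundle 1 (hA h);
  sp_B : subbundle 1 (hB h);
  sp_L : forall x v, v \in cL G x <->
    exists a b, [/\ a \in hA h x, b \in hB h x & v = hten a b];
  sp_U : forall x v, v \in hU h x <->
    exists a b, a \in hA h x /\ v = hten a b }.

Lemma line_section k (E : vbundle M k) (L : forall x, {vspace E x}) x :
  subbundle 1 L -> exists a : forall y, E y,
    rsec a x /\ \forall y \near x, a y != 0 /\ L y = <[a y]>%VS.
Proof.
move=> /(_ x)[s [rs bs]]; exists (s ord0); split; first exact: rs.
apply: filterS bs => y; rewrite (_ : enum 'I_1 = [:: ord0]); last first.
  by apply: (inj_map val_inj); rewrite val_enum_ord.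
by case/andP=> /eqP <-; rewrite /= seq1_free span_seq1.
Qed.

Variables (h : half G) (eE : forall x, hE h x -> hE h x -> C)
  (eF : forall x, hF h x -> hF h x -> C).
Hypothesis sp : spinorial eE eF.

Notation TUt := {x : M & Ut h x}.

Lemma lineA x : exists2 a, a != 0 & hA h x = <[a]>%VS.
Proof.
have [a [_ /nbhs_singleton[a0 La]]] := line_section x (sp_A sp).
by exists (a x).
Qed.

Lemma lineB x : exists2 b, b != 0 & hB h x = <[b]>%VS.
Proof.
have [b [_ /nbhs_singleton[b0 Lb]]] := line_section x (sp_B sp).
by exists (b x).
Qed.

Lemma lineA_eq x a : a \in hA h x -> a != 0 -> hA h x = <[a]>%VS.
Proof.
by have [b b0 ->] := lineA x; apply: vline_eq.
Qed.

Lemma htenZl x k (a : hE h x) f : hten (k *: a) f = k *: hten a f.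
Proof.
have [_ ll _] := sp_ten sp.
by have := @linear_sumZ _ _ _ _ _ [:: tt] (fun=> k) (fun=> a) (ll x f); rewrite !big_seq1.
Qed.

Lemma htenZr x k (a : hE h x) f : hten a (k *: f) = k *: hten a f.
Proof.
have [lr _ _] := sp_ten sp.
by have := @linear_sumZ _ _ _ _ _ [:: tt] (fun=> k) (fun=> f) (lr x a); rewrite !big_seq1.
Qed.

Lemma htenBr x (a : hE h x) f f' : hten a (f - f') = hten a f - hten a f'.
Proof.
have [lr _ _] := sp_ten sp.
by have := lr x a (-1) f' f; rewrite !scaleN1r ![- _ + _]addrC.
Qed.

(** Nondegeneracy of the two forms gives a partner [hten a' f'] whose metric product with [hten a f]
    is the nonzero number [eE a a' * eF f f']. *)
Lemma hten_neq0 x (a : hE h x) (f : hF h x) : a != 0 -> f != 0 -> hten a f != 0.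
Proof.
move=> a0 f0.
have [a' aa'] : exists a', eE a a' != 0.
  case: (pselect (exists w, eE a w != 0)) => // /forallNP H.
  case/negP: a0; apply/eqP/(sp_eE_nondeg sp) => w.
  by apply/eqP; move: (H w) => /negP; rewrite negbK.
have [f' ff'] : exists f', eF f f' != 0.
  case: (pselect (exists w, eF f w != 0)) => // /forallNP H.
  case/negP: f0; apply/eqP/(sp_eF_nondeg sp) => w.
  by apply/eqP; move: (H w) => /negP; rewrite negbK.
apply: contraNneq (mulf_neq0 aa' ff') => t0; rewrite -(sp_met sp) t0.
have [_ ll _] := cmet_bilinear G.
have := @scalar_sumZ _ _ _ _ [:: tt] (fun=> 0) (fun=> 0) (ll x (hten a' f')).
by rewrite !big_seq1 scaler0 mul0r => ->.
Qed.

Definition Ut_scale (k : C) (p : TUt) : TUt := existT (Ut h) (tag p) (k *: tagged p).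

Lemma Ut_scaleA j k p : Ut_scale j (Ut_scale k p) = Ut_scale (j * k) p.
Proof. by rewrite /Ut_scale /= scalerA. Qed.

Lemma Ut_scale1 p : Ut_scale 1 p = p.
Proof. by case: p => x v; rewrite /Ut_scale /= scale1r. Qed.

Lemma Ut_scale_nonzero k p : k != 0 -> Ut_nonzero (Ut_scale k p) <-> Ut_nonzero p.
Proof. by move=> k0; rewrite /Ut_nonzero /= scaler_eq0 negb_or k0. Qed.

Lemma Ut_at_scale k (p : TUt) a : Ut_at (p := Ut_scale k p) a = k *: Ut_at (p := p) a.
Proof. by rewrite /Ut_at /= scale_lfunE. Qed.

Lemma Ut_atZ (p : TUt) k a : Ut_at (p := p) (k *: a) = k *: Ut_at (p := p) a.
Proof. by rewrite /Ut_at !linearZ. Qed.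

(** [hA] is a line, so a homomorphism on it is determined by one nonzero vector. *)
Lemma Ut_ext x (v w : Ut h x) a : a \in hA h x -> a != 0 ->
  Ut_at (p := existT (Ut h) x v) a = Ut_at (p := existT (Ut h) x w) a -> v = w.
Proof.
move=> aA a0; rewrite /Ut_at /= => E; apply/lfunP => u.
have : vsval u \in <[a]>%VS by rewrite -(lineA_eq aA a0) subvsP.
case/vlineP=> k ku; rewrite -[u]vsvalK ku !linearZ.
by rewrite /= E.
Qed.

Lemma Ut_at_neq0 (p : TUt) a : a \in hA h (tag p) -> a != 0 ->
  Ut_nonzero p -> Ut_at (p := p) a != 0.
Proof.
case: p a => x v a aA a0 nv; apply/eqP => E; case/negP: nv; apply/eqP.
by apply: (@Ut_ext x v 0 a) => //; rewrite E /Ut_at /= zero_lfunE.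
Qed.

(** When [a] spans the line, [coord [tuple a] ord0] is the covector dual to [a]; the formula is then
    the homomorphism with [a] mapped to [f]. *)
Definition Ut_mk_fun x (a : hE h x) (f : hF h x) (u : subvs_of (hA h x)) : hF h x :=
  coord [tuple a] ord0 (vsval u) *: f.

Fact Ut_mk_linear x (a : hE h x) (f : hF h x) : linear (Ut_mk_fun a f).
Proof. by move=> k u v; rewrite /Ut_mk_fun !linearP scalerDl scalerA. Qed.

HB.instance Definition _ x (a : hE h x) (f : hF h x) :=
  GRing.isLinear.Build C (subvs_of (hA h x)) (hF h x) _ _ (Ut_mk_linear a f).

Definition Ut_mk x (a : hE h x) (f : hF h x) : Ut h x := linfun (Ut_mk_fun a f).

Lemma Ut_mk_at x (a : hE h x) (f : hF h x) : a \in hA h x -> a != 0 ->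
  Ut_at (p := existT (Ut h) x (Ut_mk a f)) a = f.
Proof.
move=> aA a0; rewrite /Ut_at /= lfunE /= /Ut_mk_fun vsprojK //.
have fa : free [tuple a] by rewrite seq1_free.
by have := coord_free ord0 ord0 fa; rewrite /= => ->; rewrite scale1r.
Qed.

Lemma Ut_proj_line (p : TUt) a : a \in hA h (tag p) -> a != 0 ->
  tagged (Ut_proj p) = <[hten a (Ut_at (p := p) a)]>%VS.
Proof.
move=> aA a0; rewrite /Ut_proj /=; set b := vpick _.
have bA : b \in <[a]>%VS by rewrite -(lineA_eq aA a0) memv_pick.
have b0 : b != 0.
  by rewrite vpick0; apply: contraNneq a0 => A0; move: aA; rewrite A0 memv0.
move: b0; case/vlineP: bA => k ->; rewrite scaler_eq0 negb_or => /andP[k0 _].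
by rewrite Ut_atZ htenZl htenZr !vlineZ.
Qed.

Lemma Ut_proj_scale k p : k != 0 -> Ut_proj (Ut_scale k p) = Ut_proj p.
Proof.
move=> k0; have [a a0 Aa] := lineA (tag p).
have aA : a \in hA h (tag p) by rewrite Aa memv_line.
have E : tagged (Ut_proj (Ut_scale k p)) = tagged (Ut_proj p) :> {vspace cV G (tag p)}.
  rewrite (Ut_proj_line (p := Ut_scale k p) aA a0) (Ut_proj_line aA a0).
  by rewrite Ut_at_scale htenZr vlineZ.
by rewrite /Ut_proj /= in E *; rewrite E.
Qed.

Lemma Ut_proj_inj (p p' : TUt) : Ut_nonzero p -> Ut_nonzero p' ->
  Ut_proj p = Ut_proj p' -> exists2 k, k != 0 & p' = Ut_scale k p.
Proof.
case: p p' => [x v] [x' v'] nv nv' E.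
have xx' : x = x' by have := congr1 (@tag _ _) E.
case: x' / xx' in v' nv' E *.
have {}E : tagged (Ut_proj (existT (Ut h) x v)) = tagged (Ut_proj (existT (Ut h) x v')).
  exact: (@existT_eq M (fun x => {vspace cV G x}) x _ _ E).
have [a a0 Aa] := lineA x.
have aA : a \in hA h x by rewrite Aa memv_line.
rewrite (Ut_proj_line (p := existT _ x v) aA a0) in E.
rewrite (Ut_proj_line (p := existT _ x v') aA a0) in E.
have /vlineP[k Ek] : hten a (Ut_at (p := existT (Ut h) x v') a) \in
   <[hten a (Ut_at (p := existT (Ut h) x v) a)]>%VS by rewrite E memv_line.
have vv : v' = k *: v.
  apply: (@Ut_ext x _ _ a) => //.
  rewrite (@Ut_at_scale k (existT (Ut h) x v) a).
  (* The difference of the two values is killed by [hten a], which is injective because [a] is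
     nonzero. *)
  apply/eqP; rewrite -subr_eq0; apply: contraTT isT => /(hten_neq0 a0).
  by rewrite htenBr htenZr Ek subrr eqxx.
exists k; last by rewrite vv.
by apply: contraNneq nv' => k0; rewrite /= vv k0 scale0r.
Qed.

Lemma Ut_proj_PU (p : TUt) : Ut_nonzero p -> PU (hU h) (Ut_proj p).
Proof.
move=> np; have [a a0 Aa] := lineA (tag p).
have aA : a \in hA h (tag p) by rewrite Aa memv_line.
rewrite /PU /=; have := Ut_proj_line aA a0; rewrite /= => ->.
rewrite dim_vline (hten_neq0 a0 (Ut_at_neq0 aA a0 np)); split=> //.
by rewrite -memvE; apply/(sp_U sp); exists a, (Ut_at (p := p) a).
Qed.

(** U = A (x) F with A a line, so every vector of U is decomposable, and a spanning vector
    [hten a f] comes from the homomorphism taking [a] to [f]. *)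
Lemma PU_Ut_proj q : PU (hU h) q -> exists2 p : TUt, Ut_nonzero p & Ut_proj p = q.
Proof.
case: q => x l; rewrite /PU /= => -[l1 lU].
have [w w0 wl] : exists2 w, w != 0 & l = <[w]>%VS.
  exists (vpick l); first by rewrite vpick0 -dimv_eq0 l1.
  apply/esym/eqP; rewrite eqEdim -memvE memv_pick /= l1 dim_vline.
  by rewrite vpick0 -dimv_eq0 l1.
have /(sp_U sp)[a [f [aA wE]]] : w \in hU h x by rewrite memvE -wl.
have a0 : a != 0.
  by apply: contraNneq w0 => E; rewrite wE E -(scale0r (0 : hE h x)) htenZl scale0r.
exists (existT (Ut h) x (Ut_mk a f)).
  apply: contraNneq w0 => /= E; have := Ut_mk_at f aA a0.
  rewrite /Ut_at /= E zero_lfunE => f0.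
  by rewrite wE -f0 -(scale0r (0 : hF h x)) htenZr scale0r.
have := Ut_proj_line (p := existT (Ut h) x (Ut_mk a f)) aA a0.
by rewrite Ut_mk_at // -wE -wl /Ut_proj /= => ->.
Qed.

End Half.

(** * Leaves *)

Section Leaves.
Variables (R : realType) (M : manifold (@holomorphic R) 2) (G : cartan M).
Notation C := (Cplx R).
Variables (h : half G) (eE : forall x, hE h x -> hE h x -> C)
  (eF : forall x, hF h x -> hF h x -> C).
Hypothesis sp : spinorial eE eF.
Notation TUt := {x : M & Ut h x}.

Lemma near_disc (u : 'rV[C]_1) : `|u| < 1 -> \forall v \near u, `|v| < 1.
Proof.
move=> u1; have d0 : 0 < 1 - `|u| by rewrite subr_gt0.
near=> v; rewrite -(subrK u v) (le_lt_trans (ler_normD _ _)) // -ltrBrDr.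
near: v; apply/nbhs_ballP; exists (1 - `|u|) => //= v.
by rewrite -ball_normE /= distrC.
Unshelve. all: by end_near. Qed.

Lemma Ut_arc_scale k (p : 'rV[C]_1 -> TUt) :
  Ut_arc p -> Ut_arc (fun u => Ut_scale k (p u)).
Proof.
move=> [ag H]; split=> // u du; have [a [s [ra rs nr]]] := H u du.
exists a, (fun y => k *: s y); split=> //; first exact: rsecZ (@rfun_cst _ _ _ k _) rs.
have [/mplot_continuous cg _ _] := ag u du.
have rn : \forall v \near u, rsec s (tag (p v)).
  exact: (@continuous_near _ _ _ _ (rsec s) cg (rsec_near rs)).
apply: filterS2 nr rn => v [aA a0 pa Da Ds] rsv; split => //.
  by rewrite Ut_at_scale pa.
have [_ _ DZ _ _] := connectionP (hDF h).
have := DZ _ (velocity (fun u => tag (p u)) v) (fun=> k) s (@rfun_cst _ _ _ k _) rsv.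
by rewrite Ds dfun_cst scale0r scaler0 addr0.
Qed.

(** The tensor product of the parallel sections [a] and [s] is parallel by the Leibniz rule [sp_D],
    and it spans the projected line. *)
Lemma Ut_arc_proj (p : 'rV[C]_1 -> TUt) : Ut_arc p ->
  (forall u, `|u| < 1 -> Ut_nonzero (p u)) -> PU_arc (hU h) (fun u => Ut_proj (p u)).
Proof.
move=> [ag H] np; split=> // u du; split; first exact: (Ut_proj_PU sp (np u du)).
have [a [s [ra rs nr]]] := H u du.
have [/mplot_continuous cg _ _] := ag u du.
have ran : \forall v \near u, rsec a (tag (p v)).
  exact: (@continuous_near _ _ _ _ (rsec a) cg (rsec_near ra)).
have rsn : \forall v \near u, rsec s (tag (p v)).
  exact: (@continuous_near _ _ _ _ (rsec s) cg (rsec_near rs)).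
exists (fun y => hten (a y) (s y)); split.
  by have [_ _ rb] := sp_ten sp; apply: rb.
apply: filterS2 (near_disc du) (filterI nr (filterI ran rsn)).
move=> v /np nv [[aA a0 pa Da Ds] [rav rsv]].
split.
- by rewrite -pa; apply: (hten_neq0 sp) => //; exact: (Ut_at_neq0 sp).
- by rewrite -pa -(Ut_proj_line sp aA a0).
- rewrite (sp_D sp) // Da Ds -(scale0r (0 : hE h (tag (p v)))) (htenZl sp) scale0r add0r.
  by rewrite -(scale0r (0 : hF h (tag (p v)))) (htenZr sp) scale0r.
Qed.

Variables (c : set M) (l : leaf_spaces h c).
Notation qV := (qV l).
Notation qT := (qT l).

Lemma same_leaf_scale k (p p' : TUt) :
  same_leaf (@Ut_arc _ _ _ h) p p' ->
  same_leaf (@Ut_arc _ _ _ h) (Ut_scale k p) (Ut_scale k p').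
Proof.
elim=> [{}p {}p' [q [u [v [aq du dv <- <-]]]]|{}p|p1 p2 p3 _ IH12 _ IH23].
- apply: rt_step; exists (fun u => Ut_scale k (q u)), u, v.
  by split=> //; exact: Ut_arc_scale.
- exact: rt_refl.
- exact: rt_trans IH12 IH23.
Qed.

Lemma qV_eq p p' : qV p = qV p' <-> same_leaf (@Ut_arc _ _ _ h) p p'.
Proof. by have [_ H _ _] := qV_quotient l; apply: H. Qed.

Lemma qV_scale k p p' : qV p = qV p' -> qV (Ut_scale k p) = qV (Ut_scale k p').
Proof. by move=> /qV_eq/(same_leaf_scale k)/qV_eq. Qed.

(** If [v] is on the leaf of a zero vector, then [2 v] is on the leaf of twice that vector, which is
    the same leaf. A leaf meets the fibre of [v] at most once, so [2 v = v] and [v = 0]. *)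
Lemma qV_nonzero p p' : qV p = qV p' -> Ut_nonzero p -> Ut_nonzero p'.
Proof.
case: p p' => [x v] [x' v'] E nv; apply/negP => /= /eqP v0.
rewrite {}v0 in E; have := qV_scale 2 E.
rewrite /Ut_scale /= scaler0 -E => /qV_fibre.
move/eqP; rewrite -subr_eq0 scaler_nat mulr2n addrK => /eqP.
by move/eqP: nv.
Qed.

Lemma same_leaf_proj (p p' : TUt) : Ut_nonzero p ->
  same_leaf (@Ut_arc _ _ _ h) p p' ->
  same_leaf (PU_arc (hU h)) (Ut_proj p) (Ut_proj p').
Proof.
move=> np pp'.
elim: pp' np => {p p'}
  [p p' [q [u [v [aq du dv <- <-]]]] nq|p|p1 p2 p3 H12 IH12 _ IH23].
- apply: rt_step; exists (fun u => Ut_proj (q u)), u, v; split=> //.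
  (* An arc projects only if it avoids zero throughout; all its points are on the leaf of the
     nonzero starting point. *)
  apply: Ut_arc_proj => // w dw; apply: (qV_nonzero _ nq); apply/qV_eq.
  by apply: rt_step; exists q, u, w.
- by move=> _; exact: rt_refl.
- move=> n1; have n2 : Ut_nonzero p2 by apply: (qV_nonzero _ n1); apply/qV_eq.
  exact: rt_trans (IH12 n1) (IH23 n2).
Qed.

Lemma qT_proj (p p' : TUt) : Ut_nonzero p -> qV p = qV p' ->
  qT (Ut_proj p) = qT (Ut_proj p').
Proof.
move=> np E; have np' := qV_nonzero E np.
have [_ H _ _] := qT_quotient l.
apply/(H _ _ (Ut_proj_PU sp np) (Ut_proj_PU sp np')).
by apply: same_leaf_proj => //; apply/qV_eq.
Qed.

Lemma leaf_rep v : exists p, c (tag p) /\ qV p = v.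
Proof. by have [p [H _]] := qV_c v; exists p. Qed.

(* A leaf in P(U) has a single point over [c]: this replaces lifting its arcs to
   the bundle, which would need parallel sections. *)
Lemma qT_proj_inv (p p' : TUt) : Ut_nonzero p -> Ut_nonzero p' ->
  qT (Ut_proj p) = qT (Ut_proj p') -> exists2 k, k != 0 & qV p' = qV (Ut_scale k p).
Proof.
move=> np np' E; have [p0 [c0 E0]] := leaf_rep (qV p).
have [p0' [c0' E0']] := leaf_rep (qV p').
have n0 : Ut_nonzero p0 by apply: qV_nonzero np.
have n0' : Ut_nonzero p0' by apply: qV_nonzero np'.
have [q [_ uq]] := qT_c (qT (Ut_proj p)).
have q0 : q = Ut_proj p0.
  by apply: uq; split=> //; [exact: (Ut_proj_PU sp n0) | exact: qT_proj].
have q0' : q = Ut_proj p0'.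
  by apply: uq; split=> //; [exact: (Ut_proj_PU sp n0') | rewrite E; exact: qT_proj].
have [k k0 Ek] := Ut_proj_inj sp n0 n0' (etrans (esym q0) q0').
by exists k; rewrite // -E0' Ek; apply: qV_scale.
Qed.

(** A representative is chosen only to obtain a total function; by [qV_scale] any other gives the
    same leaf. *)
Definition leaf_scale (k : C) (v : lV l) : lV l :=
  qV (Ut_scale k (projT1 (cid (leaf_rep v)))).

Lemma leaf_scale_qV k p : leaf_scale k (qV p) = qV (Ut_scale k p).
Proof. by rewrite /leaf_scale; case: cid => p' [_ E] /=; apply: qV_scale. Qed.

Lemma leaf_scaleA j k v : leaf_scale j (leaf_scale k v) = leaf_scale (j * k) v.
Proof. by have [p [_ <-]] := leaf_rep v; rewrite !leaf_scale_qV Ut_scaleA. Qed.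

Lemma leaf_scale1 v : leaf_scale 1 v = v.
Proof. by have [p [_ <-]] := leaf_rep v; rewrite !leaf_scale_qV Ut_scale1. Qed.

(** [zero_section] mentions zero vectors over [c] only, but every leaf has a representative over
    [c], and it vanishes when any other one does. *)
Lemma zero_section_qV p : zero_section l (qV p) <-> ~ Ut_nonzero p.
Proof.
split=> [[x cx E]|np].
  by move=> /(qV_nonzero E); rewrite /Ut_nonzero /= eqxx.
have [p0 [c0 E0]] := leaf_rep (qV p).
have n0 : ~ Ut_nonzero p0 by move/(qV_nonzero E0).
exists (tag p0) => //; rewrite -E0; congr (qV _).
by case: p0 n0 {c0 E0} => x v /negP; rewrite negbK => /eqP /= ->.
Qed.

Lemma zero_section_scale (k : C) (v : lV l) : k != 0 ->
  zero_section l (leaf_scale k v) <-> zero_section l v.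
Proof.
move=> k0; have [p [_ <-]] := leaf_rep v; rewrite leaf_scale_qV !zero_section_qV.
by split; apply: contra_not => /(Ut_scale_nonzero _ k0).
Qed.

Lemma Lstar_scale (k : C) (p : TUt) : k != 0 -> Lstar p -> Lstar (Ut_scale k p).
Proof.
move=> k0 [np H]; split; first exact/Ut_scale_nonzero.
by move=> a aA; rewrite Ut_at_scale memvZ // H.
Qed.

(** Meaningful off the zero section only: for a zero vector [Ut_proj] is the zero space, which is
    not a point of P(U). *)
Definition leaf_proj (v : lV l) : lT l := qT (Ut_proj (projT1 (cid (leaf_rep v)))).

Lemma leaf_proj_qV p : Ut_nonzero p -> leaf_proj (qV p) = qT (Ut_proj p).
Proof.
move=> np; rewrite /leaf_proj; case: cid => p' [_ E] /=.
exact: (qT_proj (qV_nonzero (esym E) np) E).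
Qed.

Lemma leaf_proj_scale (k : C) (v : lV l) : k != 0 -> ~ zero_section l v ->
  leaf_proj (leaf_scale k v) = leaf_proj v.
Proof.
have [p [_ <-]] := leaf_rep v; rewrite zero_section_qV leaf_scale_qV => k0 /contrapT np.
have kp : Ut_nonzero (Ut_scale k p) by exact/Ut_scale_nonzero.
by rewrite !leaf_proj_qV // (Ut_proj_scale sp).
Qed.

Lemma leaf_proj_inj v v' : ~ zero_section l v -> ~ zero_section l v' ->
  leaf_proj v = leaf_proj v' -> exists2 k, k != 0 & v' = leaf_scale k v.
Proof.
have [p [_ <-]] := leaf_rep v; have [p' [_ <-]] := leaf_rep v'.
rewrite !zero_section_qV => /contrapT np /contrapT np'.
rewrite !leaf_proj_qV // => /(qT_proj_inv np np')[k k0 E].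
by exists k; rewrite // leaf_scale_qV.
Qed.

End Leaves.

(** * Plots in the bundle and their projections *)

Section LeafPlots.
Variables (R : realType) (M : manifold (@holomorphic R) 2) (G : cartan M).
Notation C := (Cplx R).
Variables (h : half G) (eE : forall x, hE h x -> hE h x -> C)
  (eF : forall x, hF h x -> hF h x -> C).
Hypothesis sp : spinorial eE eF.
Notation TUt := {x : M & Ut h x}.

Lemma Ut_proj_existT (p : TUt) a : a \in hA h (tag p) -> a != 0 ->
  Ut_proj p = existT _ (tag p) <[hten a (Ut_at (p := p) a)]>%VS.
Proof. by move=> aA a0; have := Ut_proj_line sp aA a0; rewrite /Ut_proj /= => ->. Qed.

Lemma Ut_plot_scale m (p : 'rV[C]_m -> TUt) (k : 'rV[C]_m -> C) u :
  sreg k u -> Ut_plot p u -> Ut_plot (fun v => Ut_scale (k v) (p v)) u.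
Proof.
move=> hk [pg hp]; split=> // s rs; have hs := hp s rs.
apply: (@fplot_near_eq _ _ _ _ (hF h) _ (fun v => tag (p v))
   (fun v => k v *: Ut_at (p := p v) (s (tag (p v))))).
  by apply: filterE => v; rewrite Ut_at_scale.
exact: fplotZ.
Qed.

Lemma Ut_plot_cst m (p : TUt) (u : 'rV[C]_m) : Ut_plot (fun _ => p) u.
Proof.
by split=> [|s rs]; [exact: mplot_cst | exact: (@fplot_cst _ _ _ _ (hF h))].
Qed.

Lemma Ut_plot_precomp m n (g : 'rV[C]_n -> 'rV[C]_m) (p : 'rV[C]_m -> TUt) u :
  holomorphic g u -> Ut_plot p (g u) -> Ut_plot (fun v => p (g v)) u.
Proof.
move=> hg [pg hp]; split=> [|s rs]; first exact: (mplot_precomp hg pg).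
have [_ hs] := hp s rs; split=> [|e fe eu i]; first exact: (mplot_precomp hg pg).
exact: (@sreg_comp _ _ _ g (fun w => coord (fvec e (tag (p w))) i
  (Ut_at (p := p w) (s (tag (p w))))) u hg (hs e fe eu i)).
Qed.

Lemma near_section m (g : 'rV[C]_m -> M) u : mplot (M := M) g u ->
  exists a : forall y, hE h y, rsec_in (hA h) a (g u) /\
    \forall v \near u, a (g v) \in hA h (g v) /\ a (g v) != 0.
Proof.
move=> /mplot_continuous cg; have [a [ra na]] := line_section (g u) (sp_A sp).
have na' : \forall y \near g u, a y \in hA h y /\ a y != 0.
  by apply: filterS na => y [a0 ->]; rewrite memv_line.
exists a; split.
  by split=> //; apply: filterS na' => y [].
exact: (@continuous_near _ _ g u (fun y => a y \in hA h y /\ a y != 0) cg na').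
Qed.

Lemma Ut_plot_nonzero m (p : 'rV[C]_m -> TUt) u :
  Ut_plot p u -> Ut_nonzero (p u) -> \forall v \near u, Ut_nonzero (p v).
Proof.
move=> [pg hp] np; have [a [ra na]] := near_section pg.
have [aA a0] := nbhs_singleton na.
have H := fplot_near_neq0 (hp a ra) (Ut_at_neq0 sp aA a0 np).
apply: filterS H => v; apply: contraNneq => E.
by rewrite /Ut_at E zero_lfunE.
Qed.

Lemma Ut_plot_proj m (p : 'rV[C]_m -> TUt) u :
  Ut_plot p u -> Ut_nonzero (p u) -> PVplot (fun v => Ut_proj (p v)) u.
Proof.
move=> pp np; have [pg hp] := pp; have [a [ra na]] := near_section pg.
exists (fun v => existT _ (tag (p v))
  (hten (a (tag (p v))) (Ut_at (p := p v) (a (tag (p v)))))); split.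
  apply: (@fplot_bilinear_product _ _ _ _ _ _ (hE h) (hF h) (cV G) _ _
    (fun v => tag (p v)) (fun v => a (tag (p v)))
    (fun v => Ut_at (p := p v) (a (tag (p v)))) _ (sp_ten sp)).
    exact: (@rsec_fplot _ _ _ _ (hE h) _ (fun v => tag (p v)) a _ ra.1 pg).
  exact: hp.
apply: filterS2 na (Ut_plot_nonzero pp np) => v [aA a0] nv; split=> /=.
  by apply: (hten_neq0 sp) => //; apply: (Ut_at_neq0 sp).
exact: Ut_proj_existT.
Qed.

(* [hten a' _] pairs with [hten a f] through the metric, which recovers [f]. *)
Definition extract (a a' : forall y, hE h y) (f1 f2 : forall y, hF h y) x (w : cV G x) : hF h x :=
  (cmet w (hten (a' x) (f2 x)) * (eE (a x) (a' x) * eF (f1 x) (f2 x))^-1) *: f1 x +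
  (cmet w (hten (a' x) (f1 x)) * (-1 * (eE (a x) (a' x) * eF (f1 x) (f2 x)))^-1) *: f2 x.

Lemma eF_skew x (f f' : hF h x) : eF f f' = - eF f' f.
Proof.
have [lr ll _] := sp_eF sp; have alt := @sp_eF_alt _ _ _ _ _ _ sp x.
have := alt (f + f').
have D1 (g f1 f2 : hF h x) : eF (f1 + f2) g = eF f1 g + eF f2 g.
  by have := ll x g 1 f1 f2; rewrite !scale1r mul1r.
have D2 (g f1 f2 : hF h x) : eF g (f1 + f2) = eF g f1 + eF g f2.
  by have := lr x g 1 f1 f2; rewrite !scale1r mul1r.
rewrite D1 !D2 !alt add0r addr0 => /eqP.
by rewrite addr_eq0 => /eqP.
Qed.

Lemma extract_hten (a a' : forall y, hE h y) (f1 f2 : forall y, hF h y) x f :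
  eE (a x) (a' x) != 0 -> eF (f1 x) (f2 x) != 0 ->
  (exists k1 k2, f = k1 *: f1 x + k2 *: f2 x) ->
  extract a a' f1 f2 (hten (a x) f) = f.
Proof.
move=> e0 e0' [k1 [k2 ->]]; rewrite /extract !(sp_met sp).
have [lr ll _] := sp_eF sp; have alt := @sp_eF_alt _ _ _ _ _ _ sp x.
have L (g g1 g2 : hF h x) k k' : eF (k *: g1 + k' *: g2) g = k * eF g1 g + k' * eF g2 g.
  rewrite (ll x g k g1) /=; congr (_ + _).
  by have := @scalar_sumZ _ _ _ _ [:: tt] (fun=> k') (fun=> g2) (ll x g); rewrite !big_seq1.
rewrite !L !alt !mulr0 addr0 add0r (@eF_skew _ (f2 x) (f1 x)); congr (_ *: _ + _ *: _).
  by rewrite [k1 * _]mulrC mulrA mulrAC divff ?mul1r // mulf_neq0.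
rewrite mulN1r invrN !mulrN mulNr opprK.
by rewrite [k2 * _]mulrC mulrA mulrAC divff ?mul1r // mulf_neq0.
Qed.

(** The partner of [v] is sought among frame vectors so that it extends to a regular section near
    [x]. *)
Lemma form_frame k (E : vbundle M k) (b : forall x, E x -> E x -> C) x (v : E x) e :
  bilinear_form b -> nondegenerate b -> frames E e -> fdom e x -> v != 0 ->
  exists i, b x v (tnth (fvec e x) i) != 0.
Proof.
move=> [lr _ _] nb fe ex v0; case: (pselect (exists i, b x v (tnth (fvec e x) i) != 0)) => //.
move=> /forallNP H; case/negP: v0; apply/eqP/nb => w.
rewrite (frame_expand w fe ex) (scalar_sumZ _ _ _ (lr x v)) big1 // => i _.
by have := H i; move/negP; rewrite negbK => /eqP ->; rewrite mulr0.
Qed.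

(** The spanning vectors [w] lie in U, hence are [a] tensor a vector [F] for a local section [a] of
    the line; [extract] shows that [F] is regular, and the lift is the homomorphism from [a] to [F],
    rescaled to pass through [p0]. *)
Lemma PV_lift m (s : 'rV[C]_m -> {x : M & {vspace cV G x}}) u (p0 : TUt) :
  PVplot s u -> (\forall v \near u, PU (hU h) (s v)) ->
  Ut_nonzero p0 -> s u = Ut_proj p0 ->
  exists q : 'rV[C]_m -> TUt, [/\ Ut_plot q u, q u = p0 &
    \forall v \near u, Ut_nonzero (q v) /\ Ut_proj (q v) = s v].
Proof.
move=> [w [pw ws]] sU n0 su.
pose g := fun v => tag (w v); have pg : mplot (M := M) g u := pw.1.
have [a [[ra raA] na]] := near_section pg.
have [aA0 a00] := nbhs_singleton na.
have [e fe eu] := frames_cover (hE h) (g u).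
have [i ai] := form_frame (sp_eE sp) (sp_eE_nondeg sp) fe eu a00.
have [e2 fe2 eu2] := frames_cover (hF h) (g u).
set a' := fun y => tnth (fvec e y) i.
have ra' : rsec a' (g u) by apply: rsec_frame.
pose f1 := fun y => tnth (fvec e2 y) ord0.
pose f2 := fun y => tnth (fvec e2 y) (lift ord0 ord0).
have span y (f : hF h y) : fdom e2 y -> exists k1 k2, f = k1 *: f1 y + k2 *: f2 y.
  move=> ey; rewrite {1}(frame_expand f fe2 ey) big_ord_recl big_ord1.
  by do 2![eexists].
have rf1 : rsec f1 (g u) by apply: rsec_frame.
have rf2 : rsec f2 (g u) by apply: rsec_frame.
have f12 : eF (f1 (g u)) (f2 (g u)) != 0.
  have f10 : f1 (g u) != 0.
    have [_ /(_ _ eu2)/basis_free fr] := framesP fe2.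
    have := coord_free ord0 ord0 fr; rewrite -tnth_nth -/(f1 _) => E.
    by apply/eqP => f10; move: E; rewrite f10 linear0 => /eqP; rewrite eq_sym oner_eq0.
  have [j] := form_frame (sp_eF sp) (sp_eF_nondeg sp) fe2 eu2 f10.
  (* The rank is 2 and [eF] is alternating, so the frame vector pairing nontrivially with [f1] can
     only be [f2]. *)
  case: (unliftP ord0 j) => [j' ->|->]; last by rewrite (sp_eF_alt sp) eqxx.
  by rewrite (ord1 j').
have [_ _ bE] := sp_eE sp; have [_ _ bF] := sp_eF sp.
have rE : rfun (fun y => eE (a y) (a' y)) (g u) by apply: bE.
have rF : rfun (fun y => eF (f1 y) (f2 y)) (g u) by apply: bF.
have rd := rfunM rE rF.
have d0 : eE (a (g u)) (a' (g u)) * eF (f1 (g u)) (f2 (g u)) != 0 by rewrite mulf_neq0.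
have rd' := rfunM (@rfun_cst _ _ M (-1) (g u)) rd.
have d0' : -1 * (eE (a (g u)) (a' (g u)) * eF (f1 (g u)) (f2 (g u))) != 0.
  by rewrite mulf_neq0 // oppr_eq0 oner_eq0.
pose F v := extract a a' f1 f2 (tagged (w v)).
have pF : fplot (E := hF h) (g := g) F u.
  have pa' := @rsec_fplot _ _ _ _ (hE h) _ g a' u ra' pg.
  have pf1 := @rsec_fplot _ _ _ _ (hF h) _ g f1 u rf1 pg.
  have pf2 := @rsec_fplot _ _ _ _ (hF h) _ g f2 u rf2 pg.
  have pt1 := fplot_bilinear_product (sp_ten sp) pa' pf1.
  have pt2 := fplot_bilinear_product (sp_ten sp) pa' pf2.
  have pm1 := @sreg_bilinear_form _ _ _ _ _ _ _ g
    (fun v => tagged (w v)) _ u (cmet_bilinear G) pw pt1.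
  have pm2 := @sreg_bilinear_form _ _ _ _ _ _ _ g
    (fun v => tagged (w v)) _ u (cmet_bilinear G) pw pt2.
  have pd := rfun_mplot (rfunV d0 rd) pg; have pd' := rfun_mplot (rfunV d0' rd') pg.
  exact: (fplotD (fplotZ (sregM pm2 pd) pf1) (fplotZ (sregM pm1 pd') pf2)).
pose q0 v : TUt := existT (Ut h) (g v) (Ut_mk (a (g v)) (F v)).
have nE : \forall y \near g u, eE (a y) (a' y) != 0.
  exact: (@continuous_near _ _ _ _ (fun z : C => z != 0) (rfun_continuous rE) (near_neq ai)).
have nF : \forall y \near g u, eF (f1 y) (f2 y) != 0.
  exact: (@continuous_near _ _ _ _ (fun z : C => z != 0) (rfun_continuous rF) (near_neq f12)).
have good : \forall v \near u, [/\ a (g v) \in hA h (g v), a (g v) != 0,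
    eE (a (g v)) (a' (g v)) != 0, eF (f1 (g v)) (f2 (g v)) != 0 & fdom e2 (g v)].
  have H : \forall y \near g u,
      [/\ eE (a y) (a' y) != 0, eF (f1 y) (f2 y) != 0 & fdom e2 y].
    by apply: filterS3 nE nF (near_fdom fe2 eu2).
  have {}H := @continuous_near _ _ g u _ pg.1 H.
  by apply: filterS2 na H => v [aA a0] [? ? ?].
have q0s : \forall v \near u, Ut_nonzero (q0 v) /\ Ut_proj (q0 v) = s v.
  apply: filterS3 good sU ws => v [aA a0 e0 e0' ey] [_ sv] [w0 E].
  (* Membership in U writes [w v] as a tensor with first factor in the line of [a]; moving the
     scalar to the second factor identifies that factor with [F v]. *)
  have /(sp_U sp)[a1 [f [a1A wE]]] : tagged (w v) \in hU h (g v).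
    by rewrite memvE; rewrite E in sv.
  have : a1 \in <[a (g v)]>%VS by rewrite -(lineA_eq sp aA a0).
  case/vlineP=> k a1E; rewrite a1E (htenZl sp) -(htenZr sp) in wE.
  have Fv : F v = k *: f.
    by rewrite /F wE extract_hten //; exact: span.
  have Eq : Ut_at (p := q0 v) (a (g v)) = F v by rewrite Ut_mk_at.
  split.
    apply: contraNneq w0 => /= q0v; rewrite wE -Fv -Eq /Ut_at /= q0v zero_lfunE.
    by rewrite -(scale0r (0 : hF h (g v))) (htenZr sp) scale0r.
  by rewrite (Ut_proj_existT (p := q0 v) aA a0) Eq Fv -wE E.
have pq0 : Ut_plot q0 u.
  split=> // t [rt tA].
  (* A section [t] of the line is a multiple of [a], with coefficient [eE t a' / eE a a']; this is
     regular, so the image of [t] is a regular multiple of [F]. *)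
  have rt' : rfun (fun y => eE (t y) (a' y)) (g u) by apply: bE.
  have pk := rfun_mplot (rfunM rt' (rfunV ai rE)) pg.
  apply: (@fplot_near_eq _ _ _ _ (hF h) _ g
    (fun v => (eE (t (g v)) (a' (g v)) * (eE (a (g v)) (a' (g v)))^-1) *: F v));
    last exact: fplotZ.
  have tA' := @continuous_near _ _ g u _ pg.1 tA.
  apply: filterS2 good tA' => v [aA a0 e0 _ _].
  rewrite (lineA_eq sp aA a0) => /vlineP[k tE].
  have [_ ll _] := sp_eE sp.
  have := @scalar_sumZ _ _ _ _ [:: tt] (fun=> k) (fun=> a (g v)) (ll _ (a' (g v))).
  rewrite !big_seq1 => Ek; rewrite tE Ek mulfK //.
  by rewrite (Ut_atZ (p := q0 v)) Ut_mk_at.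
have [nq0 Eq0] := nbhs_singleton q0s.
(* At [u] the lift spans the same line as [p0], so it differs from it by a scalar, corrected by a
   constant factor. *)
have [k k0 ->] := Ut_proj_inj sp nq0 n0 (etrans Eq0 su).
exists (fun v => Ut_scale k (q0 v)); split=> //.
  exact: Ut_plot_scale (sreg_cst k u) pq0.
apply: filterS q0s => v [nq <-]; split; first exact/Ut_scale_nonzero.
by rewrite (Ut_proj_scale sp).
Qed.

End LeafPlots.

(** * Plots in the leaf spaces *)

Section LeafSpacePlots.
Variables (R : realType) (M : manifold (@holomorphic R) 2) (G : cartan M).
Notation C := (Cplx R).
Variables (h : half G) (eE : forall x, hE h x -> hE h x -> C)
  (eF : forall x, hF h x -> hF h x -> C).
Hypothesis sp : spinorial eE eF.
Notation TUt := {x : M & Ut h x}.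
Variables (c : set M) (l : leaf_spaces h c).
Notation qV := (qV l).
Notation qT := (qT l).

Lemma qV_mplot m (p : 'rV[C]_m -> TUt) u :
  Ut_plot p u -> mplot (M := lV l) (fun v => qV (p v)) u.
Proof.
have [_ _ H _] := qV_quotient l => pp.
by have := H m p u pp; apply; apply: filterE.
Qed.

(** The chart expression of [p] is composed with the local section of [qV] through [p0]. All
    regularity statements on [lV] reduce to the bundle in this way. *)
Lemma leaf_lift m (p : 'rV[C]_m -> lV l) u (p0 : TUt) :
  mplot (M := lV l) p u -> qV p0 = p u ->
  exists q : 'rV[C]_m -> TUt, [/\ Ut_plot q u, q u = p0 &
    \forall v \near u, qV (q v) = p v].
Proof.
move=> pp E; have [_ _ _ H] := qV_quotient l.
have [ac cx] := chart_atP (p u); set k := chart_at (p u) in ac cx.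
have := H p0 I k ac; rewrite E => /(_ cx)[s [ps sp0 qs]].
exists (fun v => s (cphi k (p v))); split=> //.
  exact: (@Ut_plot_precomp _ _ _ h _ _ (cphi k \o p) s u (pp.2 k ac cx)).
have H1 := @continuous_near _ _ _ _ _ (holomorphic_continuous (pp.2 k ac cx)) qs.
have H2 := @continuous_near _ _ _ _ (cdom k) pp.1 (near_cdom ac cx).
by apply: filterS2 H1 H2 => v [_ /= ->] kv; rewrite (cphiK ac).
Qed.

Lemma leaf_scale_mplot m (k : 'rV[C]_m -> C) (p : 'rV[C]_m -> lV l) u :
  sreg k u -> mplot (M := lV l) p u ->
  mplot (M := lV l) (fun v => leaf_scale (k v) (p v)) u.
Proof.
move=> hk pp; have [p0 [_ E]] := leaf_rep (p u).
have [q [pq _ Eq]] := leaf_lift pp E.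
apply: (mplot_near_eq _ (qV_mplot (Ut_plot_scale hk pq))).
by apply: filterS Eq => v <-; rewrite leaf_scale_qV.
Qed.

Lemma zero_section_closed : open (~` zero_section l).
Proof.
rewrite openE => v nv; rewrite /interior /=.
have [ac cx] := chart_atP v; set k := chart_at v in ac cx.
have [p0 [_ E]] := leaf_rep v.
have [|q [pq q0 Eq]] := leaf_lift (p0 := p0) (mplot_cpsi ac cx).
  by rewrite (cphiK ac).
have nq : Ut_nonzero (q (cphi k v)).
  by apply: contrapT; rewrite q0 -(zero_section_qV l) E.
have H : \forall w \near cphi k v, ~ zero_section l (cpsi k w).
  by apply: filterS2 Eq (Ut_plot_nonzero sp pq nq) => w <- ?; rewrite zero_section_qV.
have H1 := @continuous_near _ _ _ _ _ (cphi_continuous ac cx) H.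
by apply: filterS2 H1 (near_cphiK ac cx) => y ny yK; move: ny; rewrite yK.
Qed.

Lemma leaf_proj_mplot m (p : 'rV[C]_m -> lV l) u :
  mplot (M := lV l) p u -> ~ zero_section l (p u) ->
  mplot (M := lT l) (fun v => leaf_proj (p v)) u.
Proof.
move=> pp nz; have [p0 [_ E]] := leaf_rep (p u).
have [q [pq q0 Eq]] := leaf_lift pp E.
have nq : Ut_nonzero (q u) by apply: contrapT; rewrite q0 -(zero_section_qV l) E.
have nq' := Ut_plot_nonzero sp pq nq.
have [_ _ H _] := qT_quotient l.
have := H _ _ u (Ut_plot_proj sp pq nq).
have PUq : \forall v \near u, PU (hU h) (Ut_proj (q v)).
  by apply: filterS nq' => v nv; exact: (Ut_proj_PU sp nv).
move=> /(_ PUq); apply: mplot_near_eq.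
by apply: filterS2 Eq nq' => v <- nv /=; rewrite (leaf_proj_qV sp).
Qed.

(** A local section of [qT] gives a family of lines; [PV_lift] makes it a family of nonzero vectors,
    whose leaves form the section. *)
Lemma leaf_proj_section (v : lV l) k : ~ zero_section l v ->
  atlas (lT l) k -> cdom k (leaf_proj v) ->
  exists s : 'rV[C]_2 -> lV l, [/\ mplot (M := lV l) s (cphi k (leaf_proj v)),
    s (cphi k (leaf_proj v)) = v &
    \forall w \near cphi k (leaf_proj v),
      ~ zero_section l (s w) /\ leaf_proj (s w) = cpsi k w].
Proof.
have [p0 [_ <-]] := leaf_rep v; rewrite zero_section_qV => /contrapT np.
rewrite (leaf_proj_qV sp) // => ac cx; have [_ _ _ H] := qT_quotient l.
have [s [ps s0 sE]] := H _ (Ut_proj_PU sp np) k ac cx.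
have sPU : \forall w \near cphi k (qT (Ut_proj p0)), PU (hU h) (s w).
  by apply: filterS sE => w [].
have [q [pq q0 qE]] := PV_lift sp ps sPU np s0.
exists (fun w => qV (q w)); split; [exact: qV_mplot | by rewrite q0 |].
apply: filterS2 qE sE => w [nq qw] [_ qs]; rewrite zero_section_qV.
by rewrite (leaf_proj_qV sp) // qw qs; split=> //; apply.
Qed.

Lemma leaf_proj_surj (B : set (lV l)) t : open B -> zero_section l `<=` B ->
  exists v, [/\ ~ zero_section l v, B v & leaf_proj v = t].
Proof.
move=> oB zB; have [q [[qU _ qt] _]] := qT_c t.
have [p np pq] := PU_Ut_proj sp qU.
(* The disc of multiples of [p] starts in the zero section, hence in the open set [B]; a small
   nonzero multiple is then still in [B] and spans the same line. *)
have pp : mplot (M := lV l) (fun w : 'rV[C]_1 => qV (Ut_scale (w 0 0) p)) 0.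
  apply: qV_mplot; apply: Ut_plot_scale; last exact: Ut_plot_cst.
  exact: holomorphic_coord (holomorphic_id _).
have B0 : B (qV (Ut_scale ((0 : 'rV[C]_1) 0 0) p)).
  by apply: zB; rewrite zero_section_qV /Ut_nonzero /= mxE scale0r eqxx.
have := @continuous_near _ _ _ _ B pp.1 (open_nbhs_nbhs (conj oB B0)).
move=> /nbhs_ballP[e /= e0 /(_ (const_mx (e / 2)))].
have e20 : e / 2 != 0 by rewrite mulf_neq0 // ?gt_eqF // invr_gt0.
have -> : (const_mx (e / 2) : 'rV[C]_1) 0 0 = e / 2 by rewrite mxE.
have inb : ball (0 : 'rV[C]_1) e (const_mx (e / 2)).
  split=> // i j; rewrite !mxE -ball_normE /= sub0r normrN gtr0_norm ?divr_gt0 //.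
  by rewrite ltr_pdivrMr // ltr_pMr // ltr1n.
move=> /(_ inb) BB; exists (qV (Ut_scale (e / 2) p)).
have ns : Ut_nonzero (Ut_scale (e / 2) p) by apply/Ut_scale_nonzero.
split=> //; first by rewrite zero_section_qV => /(_ ns).
by rewrite (leaf_proj_qV sp) // (Ut_proj_scale sp) // pq qt.
Qed.

Lemma Lstar_proj (p : TUt) : Lstar p -> Ut_proj p = pt_of_L G (tag p).
Proof.
move=> [np Lp]; have [a a0 Aa] := lineA sp (tag p).
have aA : a \in hA h (tag p) by rewrite Aa memv_line.
rewrite (Ut_proj_existT sp aA a0) /pt_of_L; congr existT.
have aL : hten a (Ut_at (p := p) a) \in cL G (tag p).
  by apply/(sp_L sp); exists a, (Ut_at (p := p) a); split=> //; apply: Lp.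
have [b [_ /nbhs_singleton[_ Lb]]] := line_section (tag p) (cL_line G).
rewrite Lb in aL *; apply/esym/(vline_eq aL).
exact: (hten_neq0 sp a0 (Ut_at_neq0 sp aA a0 np)).
Qed.

End LeafSpacePlots.

(** * Actions glued from two pieces *)

Lemma mx_continuous (X T : topologicalType) m n (f : X -> 'M[T]_(m, n)) x :
  (forall i j, {for x, continuous (fun y => f y i j)}) -> {for x, continuous f}.
Proof.
move=> cf A [P fP PA].
have H (ij : 'I_m * 'I_n) : \forall y \near x, P ij.1 ij.2 (f y ij.1 ij.2).
  exact: (cf _ _ _ (fP _ _)).
change (\forall y \near x, A (f y)).
apply: filterS (@filter_forall _ _ _ (nbhs x) _ H) => y Py.
by apply: PA => i j; apply: (Py (i, j)).
Qed.

(** * Open embeddings and their local inverses *)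

Section OpenEmbeddings.
Variables (R : realType) (n : nat).
Notation C := (Cplx R).
Notation mfd := (manifold (@holomorphic R)).
Variables (A Z : mfd n) (D : set A) (i : A -> Z).
Hypothesis emb : open_embedding D i.

Lemma emb_inj a b : D a -> D b -> i a = i b -> a = b.
Proof. by have [_ inj _] := emb => Da Db; apply: inj; rewrite inE. Qed.

Lemma emb_inverse a : D a -> exists g : Z -> A, [/\ rmap g (i a), g (i a) = a &
  \forall z \near i a, D (g z) /\ i (g z) = z].
Proof.
have [_ _ H] := emb; move=> /H[_ [g [rg gi ig]]]; exists g; split=> //.
exact: nbhs_singleton gi.
Qed.

Lemma emb_open (B : set A) : open B -> B `<=` D -> open (i @` B).
Proof.
move=> oB BD; rewrite openE => _ [a Ba <-]; rewrite /interior /=.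
have [g [rg ga gi]] := emb_inverse (BD a Ba).
have H : \forall z \near i a, B (g z).
  apply: (@continuous_near _ _ g (i a) B (rmap_continuous rg)).
  by rewrite ga; exact: open_nbhs_nbhs.
by apply: filterS2 gi H => z [_ iz] Bz; exists (g z).
Qed.

Lemma emb_mplot m (p : 'rV[C]_m -> A) u :
  D (p u) -> mplot (M := A) p u -> mplot (M := Z) (fun v => i (p v)) u.
Proof. by have [_ _ H] := emb; move=> /H[ri _]; apply: rmap_mplot. Qed.

Lemma emb_lift m (p : 'rV[C]_m -> Z) u a : mplot (M := Z) p u -> D a -> i a = p u ->
  exists q : 'rV[C]_m -> A, [/\ mplot (M := A) q u, q u = a &
    \forall v \near u, D (q v) /\ i (q v) = p v].
Proof.
move=> pp /emb_inverse[g [rg ga gi]] E; rewrite E in rg ga gi.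
exists (g \o p); split=> //; first exact: rmap_mplot.
exact: (@continuous_near _ _ p u (fun z => D (g z) /\ i (g z) = z) pp.1 gi).
Qed.

End OpenEmbeddings.

Section GluedAction.
Variables (R : realType) (n : nat).
Notation C := (Cplx R).
Notation mfd := (manifold (@holomorphic R)).

(* The scaling [s] is defined on all of [A]; only [D] is a piece of [Z]. *)
Record scaled_piece (Z A : mfd n) (D : set A) (i : A -> Z) (s : C -> A -> A) : Prop :=
  ScaledPiece {
  piece_emb : open_embedding D i;
  pieceA : forall a b v, s a (s b v) = s (a * b) v;
  piece1 : forall v, s 1 v = v;
  piece_plot : forall m (k : 'rV[C]_m -> C) (p : 'rV[C]_m -> A) u,
    sreg k u -> k u != 0 -> mplot (M := A) p u ->
    mplot (M := A) (fun v => s (k v) (p v)) u }.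

Section OnePiece.
Variables (Z A : mfd n) (D : set A) (i : A -> Z) (s : C -> A -> A).
Hypothesis pA : scaled_piece D i s.

(** A relation rather than a function, so that the scalings of two pieces can be united before they
    are known to agree. *)
Definition piece_act (k : C) (z z' : Z) : Prop :=
  exists v, [/\ D v, D (s k v), i v = z & i (s k v) = z'].

Lemma piece_act_inv k z z' : k != 0 -> piece_act k z z' -> piece_act k^-1 z' z.
Proof.
move=> k0 [v [Dv Dkv <- <-]]; exists (s k v).
by rewrite (pieceA pA) mulVf // (piece1 pA).
Qed.

Lemma holomorphic_rsubmx (w : 'rV[C]_(1 + n)) : holomorphic rsubmx w.
Proof. by apply: filterE => v; exact: differentiable_rsubmx. Qed.

Lemma sreg_lsubmx (w : 'rV[C]_(1 + n)) : sreg (fun w => lsubmx w 0 0) w.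
Proof.
by apply: holomorphic_coord; apply: filterE => v; exact: differentiable_lsubmx.
Qed.

(** The chart of [Z] is lifted to [A], scaled there jointly in scalar and point, and mapped back,
    which stays within [D] near [w0]. This one plot yields both the openness of the domain and the
    regularity of the action. *)
Lemma piece_act_plot k z z' c : k != 0 -> piece_act k z z' -> atlas Z c -> cdom c z ->
  exists P : 'rV[C]_(1 + n) -> Z,
    let w0 := row_mx (const_mx k) (cphi c z) in
    mplot (M := Z) P w0 /\
    \forall w \near w0, lsubmx w 0 0 != 0 /\
      piece_act (lsubmx w 0 0) (cpsi c (rsubmx w)) (P w).
Proof.
move=> k0 [v [Dv Dkv <- _]] ac cx; set w0 : 'rV[C]_(1 + n) := row_mx _ _.
have pr : mplot (M := Z) (fun w => cpsi c (rsubmx w)) w0.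
  apply: (mplot_precomp (holomorphic_rsubmx w0)).
  by rewrite row_mxKr; exact: mplot_cpsi.
have Ew0 : i v = cpsi c (rsubmx w0) by rewrite row_mxKr (cphiK ac).
have El : lsubmx w0 0 0 = k by rewrite row_mxKl mxE.
have [q [pq q0 qE]] := emb_lift (piece_emb pA) pr Dv Ew0.
have l0 : lsubmx w0 0 0 != 0 by rewrite El.
have pP := piece_plot pA (sreg_lsubmx w0) l0 pq.
have DP : D (s (lsubmx w0 0 0) (q w0)) by rewrite El q0.
exists (fun w => i (s (lsubmx w 0 0) (q w))); split; first exact: (emb_mplot (piece_emb pA)).
have [oD _ _] := piece_emb pA.
have nD := @continuous_near _ _ _ _ D pP.1 (open_nbhs_nbhs (conj oD DP)).
have n0 := @continuous_near _ _ _ _ (fun z : C => z != 0)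
  (sreg_continuous (sreg_lsubmx w0)) (near_neq l0).
by apply: filterS3 qE nD n0 => w [Dq iq] Ds lw; split=> //; exists (q w).
Qed.

End OnePiece.

Section TwoPieces.
Variables (Z A B : mfd n) (DA : set A) (DB : set B) (i : A -> Z) (j : B -> Z)
  (sA : C -> A -> A) (sB : C -> B -> B) (E : A -> B -> Prop).
Hypotheses (pA : scaled_piece DA i sA) (pB : scaled_piece DB j sB).
Hypothesis gl_eq : forall a b, DA a -> DB b -> (i a = j b <-> E a b).
Hypothesis gl_scale : forall k a b, k != 0 -> E a b ->
  [/\ DA (sA k a), DB (sB k b) & E (sA k a) (sB k b)].

Definition glued_act k z z' := piece_act DA i sA k z z' \/ piece_act DB j sB k z z'.

(** Once a point is represented in [A], a step taken in the other piece can be computed in [A] too: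
    the point is then in the overlap, and [gl_scale] keeps the step inside it. *)
Lemma glued_actA k v z' : k != 0 -> DA v -> glued_act k (i v) z' ->
  DA (sA k v) /\ z' = i (sA k v).
Proof.
move=> k0 Dv [[v' [Dv' Dkv' /(emb_inj (piece_emb pA) Dv' Dv) <- <-]] //|].
move=> [w [Dw Dkw /esym/(gl_eq Dv Dw)/(gl_scale k0)[Dkv _ Ekv] <-]].
by split=> //; apply/esym/gl_eq.
Qed.

End TwoPieces.

Section Action.
Variables (Z A B : mfd n) (DA : set A) (DB : set B) (i : A -> Z) (j : B -> Z)
  (sA : C -> A -> A) (sB : C -> B -> B) (E : A -> B -> Prop).
Hypotheses (pA : scaled_piece DA i sA) (pB : scaled_piece DB j sB).
Hypothesis gl_cover : forall z, (exists2 a, DA a & i a = z) \/ (exists2 b, DB b & j b = z).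
Hypothesis gl_eq : forall a b, DA a -> DB b -> (i a = j b <-> E a b).
Hypothesis gl_scale : forall k a b, k != 0 -> E a b ->
  [/\ DA (sA k a), DB (sB k b) & E (sA k a) (sB k b)].

Notation rel := (glued_act DA DB i j sA sB).

Lemma glued_actB k w z' : k != 0 -> DB w -> rel k (j w) z' ->
  DB (sB k w) /\ z' = j (sB k w).
Proof.
move=> k0 Dw /or_comm; apply: (@glued_actA Z B A DB DA j i sB sA (fun b a => E a b)) => //.
  by move=> b a Db Da; split=> [/esym/gl_eq|/gl_eq]; [apply|move=> /(_ Da Db)].
by move=> l b a l0 /(gl_scale l0)[].
Qed.

(** All steps are computed in a piece containing [x], where the scaling is a genuine action. *)
Lemma glued_act_comp a b x y z z' : a != 0 -> b != 0 ->
  rel b x y -> rel a y z -> rel (a * b) x z' -> z = z'.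
Proof.
move=> a0 b0; have ab0 : a * b != 0 by rewrite mulf_neq0.
case: (gl_cover x) => -[v Dv <-].
  move=> /(glued_actA pA gl_eq gl_scale b0 Dv)[Dbv ->].
  move=> /(glued_actA pA gl_eq gl_scale a0 Dbv)[_ ->].
  by move=> /(glued_actA pA gl_eq gl_scale ab0 Dv)[_ ->]; rewrite (pieceA pA).
move=> /(glued_actB b0 Dv)[Dbv ->] /(glued_actB a0 Dbv)[_ ->].
by move=> /(glued_actB ab0 Dv)[_ ->]; rewrite (pieceA pB).
Qed.

Lemma glued_act1 z : rel 1 z z.
Proof.
case: (gl_cover z) => -[v Dv <-]; [left|right]; exists v.
  by rewrite (piece1 pA).
by rewrite (piece1 pB).
Qed.

Lemma glued_act_inv k z z' : k != 0 -> rel k z z' -> rel k^-1 z' z.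
Proof. by move=> k0 [H|H]; [left|right]; apply: piece_act_inv H. Qed.

(** The composition law with first scalar 1, applied to the trivial step from [y] to itself. *)
Lemma glued_act_fun k x y y' : k != 0 -> rel k x y -> rel k x y' -> y = y'.
Proof.
by move=> k0 xy xy'; apply: (glued_act_comp (oner_neq0 _) k0 xy (glued_act1 y)); rewrite mul1r.
Qed.

Definition act_dom : set (C * Z) := [set az | az.1 != 0 /\ exists z', rel az.1 az.2 z'].

(* [act k z] is the junk value [z] outside [act_dom]. *)
Definition act (k : C) (z : Z) : Z := xget z [set z' | rel k z z'].

Lemma act_rel k z z' : k != 0 -> rel k z z' -> act k z = z'.
Proof.
move=> k0 zz'; apply: (glued_act_fun k0 _ zz').
by have := @xgetPex _ z [set z' | rel k z z'] (ex_intro _ z' zz').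
Qed.

Lemma act_domP k z : act_dom (k, z) -> k != 0 /\ rel k z (act k z).
Proof. by move=> [/= k0 [z' zz']]; rewrite (act_rel k0 zz'). Qed.

Lemma act_plot k z c : act_dom (k, z) -> atlas Z c -> cdom c z ->
  exists P : 'rV[C]_(1 + n) -> Z,
    let w0 := row_mx (const_mx k) (cphi c z) in
    mplot (M := Z) P w0 /\
    \forall w \near w0, lsubmx w 0 0 != 0 /\
      rel (lsubmx w 0 0) (cpsi c (rsubmx w)) (P w).
Proof.
move=> [/= k0 [z' [H|H]]] ac cx.
  have [P [pP nP]] := piece_act_plot pA k0 H ac cx.
  by exists P; split=> //; apply: filterS nP => w [? ?]; split=> //; left.
have [P [pP nP]] := piece_act_plot pB k0 H ac cx.
by exists P; split=> //; apply: filterS nP => w [? ?]; split=> //; right.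
Qed.

Lemma act_dom_open : open act_dom.
Proof.
rewrite openE => -[k z] kz; rewrite /interior.
have [ac cx] := chart_atP z; set c := chart_at z in ac cx.
have [P [_ nP]] := act_plot kz ac cx.
(* [f] reads a pair in the product chart; the neighbourhood of [w0] given by [act_plot] is pulled
   back along it. *)
pose f (az : C * Z) : 'rV[C]_(1 + n) := row_mx (const_mx az.1) (cphi c az.2).
have cf : {for (k, z), continuous f}.
  apply: mx_continuous => i0 j0; case: (split_ordP j0) => j' ->.
    rewrite (_ : (fun _ => _) = fst); first exact: cvg_fst.
    by apply/funext => y; rewrite row_mxEl mxE.
  rewrite (_ : (fun _ => _) = (fun y => cphi c y i0 j') \o snd); last first.
    by apply/funext => y; rewrite row_mxEr.
  apply: continuous_comp; first exact: cvg_snd.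
  apply: (@continuous_comp _ _ _ (cphi c) (fun m => m i0 j')).
    exact: cphi_continuous.
  exact: coord_continuous.
have H1 := @continuous_near _ _ f (k, z) _ cf nP.
have H2 : \forall az \near (k, z), cdom c az.2.
  exact: (@continuous_near _ _ snd (k, z) (cdom c) cvg_snd (near_cdom ac cx)).
apply: filterS2 H1 H2 => -[k' z'] /=; rewrite row_mxKl row_mxKr mxE => -[k0 rk] cz'.
by split=> //; exists (P (f (k', z'))); rewrite /= -{1}(cphiK ac cz').
Qed.

Lemma act_regular : regular_action act_dom act.
Proof.
move=> k z kz c ac cx; have [P [pP nP]] := act_plot kz ac cx.
apply: (mplot_near_eq _ pP); apply: filterS nP => w [k0 rk].
by rewrite (act_rel k0 rk).
Qed.

Lemma act_local : local_Gm_action act_dom act.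
Proof.
split.
- exact: act_dom_open.
- by move=> a x [].
- move=> x; split; first by split; [exact: oner_neq0 | exists x; exact: glued_act1].
  exact: act_rel (oner_neq0 _) (glued_act1 x).
- move=> a b x /act_domP[b0 xb] /act_domP[a0 xba] /act_domP[ab0 xab].
  exact: glued_act_comp xb xba xab.
- move=> a x /act_domP[a0 xa]; have xa' := glued_act_inv a0 xa.
  have a0' : a^-1 != 0 by rewrite invr_eq0.
  by split; [split=> //; exists x | exact: act_rel].
Qed.

End Action.
End GluedAction.

(** * Quotients by glued actions *)

Section GluedQuotient.
Variables (R : realType) (n d : nat).
Notation C := (Cplx R).
Notation mfd := (manifold (@holomorphic R)).

(** Here [z] stands for the zero section and [p] for the projection to [T]. Scaling, sections and
    fibres are controlled on all of [A], while [Pi] is compared with [p] only on the piece [D]. *)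
Record projected_piece (Z A : mfd n) (T : mfd d) (Pi : Z -> T) (D : set A) (i : A -> Z)
    (s : C -> A -> A) (z : set A) (p : A -> T) : Prop := ProjectedPiece {
  pp_scaled :> scaled_piece D i s;
  pp_open : open (~` z);
  pp_sub : z `<=` D;
  pp_scale0 : forall k v, k != 0 -> z (s k v) <-> z v;
  pp_scale : forall k v, k != 0 -> ~ z v -> p (s k v) = p v;
  pp_Pi : forall v, D v -> ~ z v -> Pi (i v) = p v;
  pp_plot : forall m (q : 'rV[C]_m -> A) u, mplot (M := A) q u -> ~ z (q u) ->
    mplot (M := T) (fun v => p (q v)) u;
  pp_sec : forall v c, ~ z v -> atlas T c -> cdom c (p v) ->
    exists q : 'rV[C]_d -> A, [/\ mplot (M := A) q (cphi c (p v)), q (cphi c (p v)) = v &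
      \forall w \near cphi c (p v), ~ z (q w) /\ p (q w) = cpsi c w];
  pp_inj : forall v v', ~ z v -> ~ z v' -> p v = p v' -> exists2 k, k != 0 & v' = s k v }.

Section OnePiece.
Variables (Z A : mfd n) (T : mfd d) (Pi : Z -> T) (D : set A) (i : A -> Z)
  (s : C -> A -> A) (z : set A) (p : A -> T).
Hypothesis pp : projected_piece Pi D i s z p.

Lemma piece_proj_plot m (q : 'rV[C]_m -> Z) u a : D a -> ~ z a -> i a = q u ->
  mplot (M := Z) q u -> mplot (M := T) (Pi \o q) u.
Proof.
move=> Da za E pq; have [r [pr r0 rE]] := emb_lift (piece_emb pp) pq Da E.
have zr : (~` z) (r u) by rewrite r0.
apply: (mplot_near_eq _ (pp_plot pp pr zr)).
have nz := @continuous_near _ _ _ _ (~` z) pr.1 (open_nbhs_nbhs (conj (pp_open pp) zr)).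
by apply: filterS2 rE nz => v [Dr /= <-] zv; rewrite (pp_Pi pp).
Qed.

Lemma piece_section a c : D a -> ~ z a -> atlas T c -> cdom c (Pi (i a)) ->
  exists q : 'rV[C]_d -> Z, [/\ mplot (M := Z) q (cphi c (Pi (i a))),
    q (cphi c (Pi (i a))) = i a &
    \forall w \near cphi c (Pi (i a)),
      (exists a', [/\ D a', ~ z a' & i a' = q w]) /\ Pi (q w) = cpsi c w].
Proof.
move=> Da za ac; rewrite (pp_Pi pp) // => cx.
have [q [pq q0 qE]] := pp_sec pp za ac cx.
have Dq : D (q (cphi c (p a))) by rewrite q0.
have [oD _ _] := piece_emb pp.
have nD := @continuous_near _ _ _ _ D pq.1 (open_nbhs_nbhs (conj oD Dq)).
exists (i \o q); split; [exact: (emb_mplot (piece_emb pp)) | by rewrite /= q0 |].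
apply: filterS2 qE nD => w [zw pw] Dw /=; split; first by exists (q w).
by rewrite (pp_Pi pp).
Qed.

End OnePiece.

Section TwoPieces.
Variables (Z A B : mfd n) (T : mfd d) (Pi : Z -> T) (DA : set A) (DB : set B)
  (i : A -> Z) (j : B -> Z) (sA : C -> A -> A) (sB : C -> B -> B)
  (zA : set A) (zB : set B) (pA : A -> T) (pB : B -> T) (E : A -> B -> Prop).
Hypotheses (ppA : projected_piece Pi DA i sA zA pA) (ppB : projected_piece Pi DB j sB zB pB).
Hypothesis gl_cover : forall z, (exists2 a, DA a & i a = z) \/ (exists2 b, DB b & j b = z).
Hypothesis gl_eq : forall a b, DA a -> DB b -> (i a = j b <-> E a b).
Hypothesis gl_scale : forall k a b, k != 0 -> E a b ->
  [/\ DA (sA k a), DB (sB k b) & E (sA k a) (sB k b)].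
Hypothesis gl_nz : forall a b, E a b -> ~ zA a /\ ~ zB b.
Hypothesis gl_cross : forall a b, ~ zA a -> ~ zB b -> pA a = pB b ->
  exists k, [/\ k != 0, DA a, DB (sB k b) & E a (sB k b)].
Hypothesis gl_surj : forall t, (exists a, [/\ DA a, ~ zA a & pA a = t]) \/
  (exists b, [/\ DB b, ~ zB b & pB b = t]).

Notation rel := (glued_act DA DB i j sA sB).
Notation dom := (act_dom DA DB i j sA sB).
Notation act := (act DA DB i j sA sB).
Notation nz := (~` (i @` zA `|` j @` zB)).

(** The overlap of the pieces avoids both zero sections, so a point coming from [A] can be tested in
    [A] alone. *)
Lemma nzA a : DA a -> nz (i a) <-> ~ zA a.
Proof.
move=> Da; split=> [H za|za]; first by apply: H; left; exists a.
case=> [[a' za' /(emb_inj (piece_emb ppA) (pp_sub ppA za') Da) E']|[b zb /esym]].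
  by apply: za; rewrite -E'.
by move=> /(gl_eq Da (pp_sub ppB zb))/gl_nz[].
Qed.

Lemma nzB b : DB b -> nz (j b) <-> ~ zB b.
Proof.
move=> Db; split=> [H zb|zb]; first by apply: H; right; exists b.
case=> [[a za]|[b' zb' /(emb_inj (piece_emb ppB) (pp_sub ppB zb') Db) E']].
  by move=> /(gl_eq (pp_sub ppA za) Db)/gl_nz[].
by apply: zb; rewrite -E'.
Qed.

Lemma nz_cover z : nz z -> (exists a, [/\ DA a, ~ zA a & i a = z]) \/
  (exists b, [/\ DB b, ~ zB b & j b = z]).
Proof.
case: (gl_cover z) => -[v Dv <-]; first by move/(nzA Dv); left; exists v.
by move/(nzB Dv); right; exists v.
Qed.

Lemma nz_open : open nz.
Proof.
(* As a complement of images the set is not visibly open; it is rewritten as a union of images of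
   open sets under open embeddings. *)
have -> : nz = i @` (DA `&` ~` zA) `|` j @` (DB `&` ~` zB).
  apply/seteqP; split=> z.
    by move=> /nz_cover[] [v [Dv zv <-]]; [left|right]; exists v.
  by move=> [] [v [Dv zv] <-]; [apply/nzA | apply/nzB].
have [oA _ _] := piece_emb ppA; have [oB _ _] := piece_emb ppB.
apply: openU.
  apply: (emb_open (piece_emb ppA)); last by move=> ? [].
  by apply: openI => //; exact: pp_open ppA.
apply: (emb_open (piece_emb ppB)); last by move=> ? [].
by apply: openI => //; exact: pp_open ppB.
Qed.

Lemma glued_act_nz k z z' : k != 0 -> rel k z z' ->
  (nz z <-> nz z') /\ (nz z -> Pi z = Pi z').
Proof.
move=> k0 [] [v [Dv Dkv <- <-]].
  rewrite !nzA // (pp_scale0 ppA) //; split=> // zv.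
  by rewrite !(pp_Pi ppA) ?(pp_scale ppA) // (pp_scale0 ppA).
rewrite !nzB // (pp_scale0 ppB) //; split=> // zv.
by rewrite !(pp_Pi ppB) ?(pp_scale ppB) // (pp_scale0 ppB).
Qed.

Lemma act_domE a z : dom (a, z) -> a != 0 /\ rel a z (act a z).
Proof. exact: (act_domP ppA ppB gl_cover gl_eq gl_scale). Qed.

Lemma rel_orbit k z z' : k != 0 -> rel k z z' -> local_orbit dom act z z'.
Proof.
move=> k0 zz'; apply: rst_step; exists k; split; first by split=> //; exists z'.
by rewrite (act_rel ppA ppB gl_cover gl_eq gl_scale k0 zz').
Qed.

Lemma orbit_Pi z z' : local_orbit dom act z z' ->
  (nz z <-> nz z') /\ (nz z -> Pi z = Pi z').
Proof.
elim=> {z z'} [z z' [k [/act_domE[k0 zz'] ->]]|z|z z' _ [H P]|x y z _ [H P] _ [H' P']].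
- exact: glued_act_nz zz'.
- by [].
- by split=> [|nz']; [exact: iff_sym | rewrite P //; apply/H].
- by split=> [|nx]; [exact: iff_trans H H' | rewrite P // P' //; apply/H].
Qed.

(** Each case takes one step or the inverse of one. For points in different pieces, [gl_cross]
    scales the one in [B] until it is glued to the one in [A]. *)
Lemma Pi_orbit z z' : nz z -> nz z' -> Pi z = Pi z' -> local_orbit dom act z z'.
Proof.
move=> /nz_cover[] [v [Dv zv <-]] /nz_cover[] [w [Dw zw <-]].
- rewrite !(pp_Pi ppA) // => /(pp_inj ppA zv zw)[k k0 wE]; rewrite wE in Dw zw *.
  by apply: (rel_orbit k0); left; exists v.
- rewrite (pp_Pi ppA) // (pp_Pi ppB) // => /(gl_cross zv zw)[k [k0 _ Dk Ek]].
  move/(gl_eq Dv Dk): Ek => ->; apply: rst_sym; apply: (rel_orbit k0).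
  by right; exists w.
- rewrite (pp_Pi ppA) // (pp_Pi ppB) // => /esym/(gl_cross zw zv)[k [k0 _ Dk Ek]].
  by move/(gl_eq Dw Dk): Ek => ->; apply: (rel_orbit k0); right; exists v.
- rewrite !(pp_Pi ppB) // => /(pp_inj ppB zv zw)[k k0 wE]; rewrite wE in Dw zw *.
  by apply: (rel_orbit k0); right; exists v.
Qed.

Lemma Pi_quotient : quotient_map (@mplot _ _ _ Z) nz Pi (local_orbit dom act).
Proof.
split.
- move=> t; case: (gl_surj t) => -[v [Dv zv <-]].
    by exists (i v); [exact/nzA | rewrite (pp_Pi ppA)].
  by exists (j v); [exact/nzB | rewrite (pp_Pi ppB)].
- by move=> x y nx ny; split=> [|/orbit_Pi[_]]; [exact: Pi_orbit | apply].
- move=> m p u pp /nbhs_singleton /nz_cover[] [v [Dv zv E']].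
    exact: (piece_proj_plot ppA Dv zv E').
  exact: (piece_proj_plot ppB Dv zv E').
- move=> x /nz_cover[] [v [Dv zv <-]] c ac cx.
    have [q [pq q0 qE]] := piece_section ppA Dv zv ac cx.
    exists q; split=> //; apply: filterS qE => w [[a [Da za <-]] Pa].
    by split=> //; apply/nzA.
  have [q [pq q0 qE]] := piece_section ppB Dv zv ac cx.
  exists q; split=> //; apply: filterS qE => w [[a [Da za <-]] Pa].
  by split=> //; apply/nzB.
Qed.

End TwoPieces.
End GluedQuotient.

(** * The plus and minus halves as instances of the same structure *)

Section Halves.
Variables (R : realType) (M : manifold (@holomorphic R) 2) (G : cartan M).
Variables (U : null_planes G) (s : spinors U).

Lemma spinorial_plus : spinorial (h := half_plus s) (@eps _ _ _ _ _ s) (@epsh _ _ _ _ _ s).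
Proof.
split.
- exact: tens_bilinear.
- exact: eps_bilinear.
- exact: eps_nondeg.
- exact: epsh_bilinear.
- exact: epsh_alt.
- exact: epsh_nondeg.
- exact: tens_met.
- exact: tens_D.
- exact: sLp_line.
- exact: sLm_line.
- exact: tens_L.
- exact: tens_Up.
Qed.

Lemma spinorial_minus : spinorial (h := half_minus s) (@epsh _ _ _ _ _ s) (@eps _ _ _ _ _ s).
Proof.
split.
- have [lr ll b] := tens_bilinear s.
  by split=> // x t t' rt rt'; exact: b.
- exact: epsh_bilinear.
- exact: epsh_nondeg.
- exact: eps_bilinear.
- exact: eps_alt.
- exact: eps_nondeg.
- by move=> x a a' f f'; rewrite mulrC; exact: tens_met.
- by move=> x X t t' rt rt'; rewrite addrC; exact: (tens_D X rt' rt).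
- exact: sLm_line.
- exact: sLp_line.
- move=> x v; split=> [/(tens_L s)|] [a [b [? ? ->]]]; first by exists b, a.
  by apply/(tens_L s); exists b, a.
- move=> x v; split=> [/(tens_Um s)|] [a [b [? ->]]]; first by exists b, a.
  by apply/(tens_Um s); exists b, a.
Qed.

End Halves.

(** * The spaces Z and T *)

(* [k] acts on V+ ([b = false]) as itself and on V- ([b = true]) as its inverse. *)
Definition inv_if (K : unitRingType) (b : bool) (k : K) : K := if b then k^-1 else k.

Section LeafPiece.
Variables (R : realType) (M : manifold (@holomorphic R) 2) (G : cartan M).
Notation C := (Cplx R).
Variables (h : half G) (eE : forall x, hE h x -> hE h x -> C)
  (eF : forall x, hF h x -> hF h x -> C).
Hypothesis sp : spinorial eE eF.
Variables (c : set M) (l : leaf_spaces h c).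

Lemma leaf_piece b (Z : manifold (@holomorphic R) 3) (T : manifold (@holomorphic R) 2)
    (D : set (lV l)) (i : lV l -> Z) (j : lT l -> T) (Pi : Z -> T) :
  open_embedding D i -> open_embedding setT j -> zero_section l `<=` D ->
  (forall p, c (tag p) -> Ut_nonzero p -> D (qV l p) ->
     Pi (i (qV l p)) = j (qT l (Ut_proj p))) ->
  projected_piece Pi D i (fun k => leaf_scale (inv_if b k)) (zero_section l)
    (fun v => j (leaf_proj v)).
Proof.
move=> emb embT zD PiE.
have inv_neq0 k : k != 0 -> inv_if b k != 0 by rewrite /inv_if; case: b => //; rewrite invr_eq0.
split.
- split=> //.
  + by move=> x y v; rewrite leaf_scaleA /inv_if; case: b {inv_neq0} => //; rewrite invfM.
  + by move=> v; rewrite /inv_if invr1 if_same leaf_scale1.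
  + move=> m k p u hk k0; apply: leaf_scale_mplot; rewrite /inv_if; case: b {inv_neq0} => //.
    exact: sregV.
- exact: (zero_section_closed sp).
- exact: zD.
- by move=> k v /inv_neq0; exact: zero_section_scale.
- by move=> k v /inv_neq0 k0 nv; rewrite (leaf_proj_scale sp).
- move=> v Dv; have [p [cp pv]] := leaf_rep v; rewrite -pv zero_section_qV in Dv *.
  by move=> /contrapT np; rewrite PiE // (leaf_proj_qV sp).
- move=> m q u pq nq.
  exact: (emb_mplot embT _ (leaf_proj_mplot sp pq nq)).
(* Sections of [leaf_proj] are given over charts of [lT], but [k] is a chart of [T]: the local
   inverse [r] of the embedding [j] carries [k] back, and [cphi k' \o r] is the change of
   parameters. *)
- move=> v k nv ak ck; have [ac cv] := chart_atP (leaf_proj v).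
  set k' := chart_at (leaf_proj v) in ac cv.
  have [q [pq q0 qE]] := leaf_proj_section sp nv ac cv.
  have jv : j (leaf_proj v) = cpsi k (cphi k (j (leaf_proj v))) by rewrite (cphiK ak).
  have [r [pr r0 rE]] := emb_lift embT (mplot_cpsi ak ck) (I : setT (leaf_proj v)) jv.
  set w0 := cphi k (j (leaf_proj v)) in r0 rE pr *.
  have hr : holomorphic (cphi k' \o r) w0 by apply: pr.2 => //; rewrite r0.
  have Ew : (cphi k' \o r) w0 = cphi k' (leaf_proj v) by rewrite /= r0.
  have pqr : mplot (M := lV l) (q \o (cphi k' \o r)) w0.
    by apply: mplot_precomp => //; rewrite Ew.
  exists (q \o (cphi k' \o r)); split=> //; first by rewrite /= r0.
  have := @continuous_near _ _ (cphi k' \o r) w0 (fun w => ~ zero_section l (q w) /\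
    leaf_proj (q w) = cpsi k' w) (holomorphic_continuous hr).
  rewrite Ew => /(_ qE) H1.
  have := @continuous_near _ _ r w0 (cdom k') pr.1.
  rewrite r0 => /(_ (near_cdom ac cv)) H2.
  apply: filterS3 H1 H2 rE => w [nw qw] rw [_ jw]; split=> //.
  by rewrite qw /= (cphiK ac).
- move=> v v' nv nv' /(emb_inj embT I I).
  move=> /(leaf_proj_inj sp nv nv')[k k0 ->]; exists (inv_if b k); first exact: inv_neq0.
  by rewrite /inv_if; case: b {inv_neq0} => //; rewrite invrK.
Qed.

Lemma Lstar_mk x (a : hE h x) (b : hF h x) : a \in hA h x -> a != 0 ->
  b \in hB h x -> b != 0 -> Lstar (existT (Ut h) x (Ut_mk a b)).
Proof.
move=> aA a0 bB b0; have Eb := Ut_mk_at b aA a0; split.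
  by apply: contraNneq b0 => /= E; rewrite -Eb /Ut_at /= E zero_lfunE.
move=> a' /=; rewrite (lineA_eq sp aA a0) => /vlineP[k ->].
by rewrite (@Ut_atZ _ _ _ _ (existT _ x (Ut_mk a b))) Eb memvZ.
Qed.

Lemma Lstar_leaf p : Lstar p ->
  [set q | qV l q = qV l p] `&` @Lstar _ _ _ h = [set p].
Proof.
move=> Lp; apply/seteqP; split=> [q [/= E Lq]|q /= -> //].
exact: (qV_L Lq Lp E).
Qed.

End LeafPiece.

Theorem proposition16
  (R : realType)
  (* a real-analytic surface with a conformal Cartan geometry *)
  (S : manifold (@real_analytic R) 2) (GR : cartan S)
  (S_hausdorff : hausdorff_space S) (GR_signature : lorentzian GR)
  (* and its complexification *)
  (Sigma : manifold (@holomorphic R) 2) (G : cartan Sigma)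
  (Sigma_hausdorff : hausdorff_space Sigma)
  (Sigma_connected : connected [set: Sigma])
  (cx : complexification GR G)
  (U : null_planes G) (s : spinors U)
  (convex : forall x y : Sigma,
     exists! z, same_curve (Up U) x z /\ same_curve (Um U) y z)
  (* c_0^+ and c_0^- are the two null curves through o *)
  (o : Sigma)
  (lp : leaf_spaces (half_plus s) [set y | same_curve (Um U) o y])
  (lm : leaf_spaces (half_minus s) [set y | same_curve (Up U) o y])
  (T : manifold (@holomorphic R) 2) (jp : lT lp -> T) (jm : lT lm -> T)
  (T_glued : is_T jp jm)
  (Bp : set (lV lp)) (Bm : set (lV lm))
  (Bp_tube : tubular Bp) (Bm_tube : tubular Bm) (B_small : small_tubes Bp Bm)
  (Z : manifold (@holomorphic R) 3) (ip : lV lp -> Z) (im : lV lm -> Z)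
  (Z_glued : is_Z Bp Bm ip im)
  (Pi : Z -> T) (Pi_proj : is_projection Bp Bm ip im jp jm Pi) :
  open (nonzero_part ip im) /\
  exists (dom : set (Cplx R * Z)) (act : Cplx R -> Z -> Z),
    [/\ local_Gm_action dom act,
        regular_action dom act,
        (forall a z, dom (a, z) ->
           (nonzero_part ip im z <-> nonzero_part ip im (act a z))) &
        quotient_map (@mplot _ _ _ Z) (nonzero_part ip im) Pi
          (local_orbit dom act)].
Proof.
have spp := spinorial_plus s; have spm := spinorial_minus s.
have [jp_emb jm_emb T_cover T_eq] := T_glued.
have [ip_emb im_emb Z_cover Z_eq] := Z_glued.
have [Pip Pim] := Pi_proj.
have [oBp zBp _] := Bp_tube; have [oBm zBm _] := Bm_tube.
have zDp : zero_section lp `<=` Zspace Bp by move=> v /zBp; left.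
have zDm : zero_section lm `<=` Zspace Bm by move=> v /zBm; left.
have ppp := leaf_piece spp false ip_emb jp_emb zDp Pip.
have ppm := leaf_piece spm true im_emb jm_emb zDm Pim.
have Z_relW vp vm : Z_rel vp vm -> exists x (a : Ut (half_plus s) x) (b : Ut (half_minus s) x),
  [/\ Lstar (existT _ x a), Lstar (existT _ x b), qV lp (existT _ x a) = vp,
      qV lm (existT _ x b) = vm &
      forall w, w \in sLp s x ->
        Ut_at (h := half_minus s) (p := existT _ x b)
          (Ut_at (h := half_plus s) (p := existT _ x a) w) = w].
  move=> [x [a [b [Ea Eb ab]]]]; exists x, a, b.
  have [? ?] : ([set p | qV lp p = vp] `&` @Lstar _ _ _ (half_plus s)) (existT _ x a).
    by rewrite Ea.
  have [? ?] : ([set p | qV lm p = vm] `&` @Lstar _ _ _ (half_minus s)) (existT _ x b).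
    by rewrite Eb.
  by split.
have rel_scale k vp vm : k != 0 -> Z_rel vp vm ->
  [/\ Zspace Bp (leaf_scale (inv_if false k) vp),
      Zspace Bm (leaf_scale (inv_if true k) vm) &
      Z_rel (leaf_scale (inv_if false k) vp) (leaf_scale (inv_if true k) vm)].
  move=> k0 /Z_relW[x [a [b [La Lb <- <- ab]]]] /=.
  have k0' : k^-1 != 0 by rewrite invr_eq0.
  rewrite !leaf_scale_qV; have La' := Lstar_scale k0 La; have Lb' := Lstar_scale k0' Lb.
  (* The scaled leaves still meet [Lstar], so they lie in the [Wspace] part of each piece, however
     large [k] or its inverse may be. *)
  split; [by right; right; eexists; eauto|by right; right; eexists; eauto|].
  exists x, (k *: a), (k^-1 *: b); split; [exact: Lstar_leaf|exact: Lstar_leaf|].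
  move=> w wA.
  rewrite (@Ut_at_scale _ _ _ _ k (existT _ x a)) (@Ut_at_scale _ _ _ _ k^-1 (existT _ x b)).
  by rewrite (@Ut_atZ _ _ _ (half_minus s) (existT _ x b)) ab // scalerA mulVf // scale1r.
have rel_nz vp vm : Z_rel vp vm -> ~ zero_section lp vp /\ ~ zero_section lm vm.
  move=> /Z_relW[x [a [b [[na _] [nb _] <- <- _]]]].
  by rewrite !zero_section_qV; split; apply.
have cross vp vm : ~ zero_section lp vp -> ~ zero_section lm vm ->
  jp (leaf_proj vp) = jm (leaf_proj vm) ->
  exists k, [/\ k != 0, Zspace Bp vp, Zspace Bm (leaf_scale (inv_if true k) vm)
    & Z_rel vp (leaf_scale (inv_if true k) vm)].
  (* Equality in [T] provides a point [x] whose null line lies on both projected leaves. *)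
  move=> np nm /(T_eq _ _ I I)[x /seteqP[_ /(_ _ erefl)[[_ xp] [_ xm]]]].
  have [a a0 Aa] := lineA spp x; have [b b0 Bb] := lineB spp x.
  have aA : a \in sLp s x by rewrite /= in Aa; rewrite Aa memv_line.
  have bB : b \in sLm s x by rewrite /= in Bb; rewrite Bb memv_line.
  (* The homomorphisms taking [a] to [b] and [b] to [a] are inverse to each other on the null lines,
     so their pairing is 1: a reference pair of glued leaves through the null line at [x]. *)
  have La := Lstar_mk spp aA a0 bB b0; have Lb := Lstar_mk spm bB b0 aA a0.
  set p := existT _ x _ in La; set q := existT _ x _ in Lb.
  have ab : Z_rel (qV lp p) (qV lm q).
    exists x, (Ut_mk (h := half_plus s) a b), (Ut_mk (h := half_minus s) b a).
    split; [exact: Lstar_leaf|exact: Lstar_leaf|move=> w].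
    rewrite /= in Aa; rewrite Aa => /vlineP[k ->].
    rewrite (@Ut_atZ _ _ _ (half_plus s) p) (@Ut_atZ _ _ _ (half_minus s) q).
    by rewrite (@Ut_mk_at _ _ _ (half_plus s)) // (@Ut_mk_at _ _ _ (half_minus s)).
  have [k k0 ->] : exists2 k, k != 0 & vp = leaf_scale k (qV lp p).
    apply: (leaf_proj_inj spp) => //; first by rewrite zero_section_qV; apply; exact: La.1.
    by rewrite (leaf_proj_qV spp lp La.1) (Lstar_proj spp La) xp.
  have [k' k0' ->] : exists2 k, k != 0 & vm = leaf_scale k (qV lm q).
    apply: (leaf_proj_inj spm) => //; first by rewrite zero_section_qV; apply; exact: Lb.1.
    by rewrite (leaf_proj_qV spm lm Lb.1) (Lstar_proj spm Lb) xm.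
  (* [vp] is [k] times the reference leaf, so its partner is [k^-1] times the other one. As [vm] is
     [k'] times that one, the scalar is found from [(k * k')^-1 * k' = k^-1]. *)
  exists (k * k'); split; first exact: mulf_neq0.
  - by have [] := rel_scale k _ _ k0 ab.
  - rewrite leaf_scaleA /inv_if invfM mulfVK //.
    by have [] := rel_scale k _ _ k0 ab.
  - rewrite leaf_scaleA /inv_if invfM mulfVK //.
    by have [] := rel_scale k _ _ k0 ab.
have surj t : (exists v, [/\ Zspace Bp v, ~ zero_section lp v & jp (leaf_proj v) = t]) \/
  (exists v, [/\ Zspace Bm v, ~ zero_section lm v & jm (leaf_proj v) = t]).
  case: (T_cover t) => -[t' _ <-]; [left|right].
    by have [v [? ? <-]] := leaf_proj_surj spp t' oBp zBp; exists v; split=> //; left.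
  by have [v [? ? <-]] := leaf_proj_surj spm t' oBm zBm; exists v; split=> //; left.
split; first exact: (nz_open ppp ppm Z_cover Z_eq rel_nz).
exists (act_dom (Zspace Bp) (Zspace Bm) ip im
  (fun k => leaf_scale (inv_if false k)) (fun k => leaf_scale (inv_if true k))).
exists (act (Zspace Bp) (Zspace Bm) ip im
  (fun k => leaf_scale (inv_if false k)) (fun k => leaf_scale (inv_if true k))).
split.
- exact: (act_local ppp ppm Z_cover Z_eq rel_scale).
- exact: (act_regular ppp ppm Z_cover Z_eq rel_scale).
- move=> a z /(act_domE ppp ppm Z_cover Z_eq rel_scale)[a0 zz'].
  by have [] := glued_act_nz ppp ppm Z_eq rel_nz a0 zz'.
- exact: (Pi_quotient ppp ppm Z_cover Z_eq rel_scale rel_nz cross surj).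
Qed.
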